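(* There exist universal constants $C, C' > 0$ such that for every $\epsilon > 0$ and every $n \ge 1$ the following holds. (1) If $F$ is an SCF on $n$ voters and three alternatives such that the distance of $F$ from every dictatorship is at least $\epsilon$ and, for every alternative $a$, $\Pr_{x \in (L_3)^n}[F(x)=a] \ge \epsilon$, then \[ \sum_{i=1}^n M_i(F) \ge C \epsilon^6. \] (2) If, in addition, $F$ is neutral, then \[ \sum_{i=1}^n M_i(F) \ge C' \epsilon^2. \]
   Context: $L_m$ denotes the set of linear orders on a set of $m$ alternatives. A social choice function (SCF) on $n$ voters and $m$ alternatives is a function $F:(L_m)^n \to \{1,\dots,m\}$; an element $x=(x_1,\dots,x_n)\in(L_m)^n$ is a profile, written $(x_i,x_{-i})$ when singling out voter $i$. A profitable manipulation by voter $i$ at profile $x$ is an order $x_i' \in L_m$ such that voter $i$, according to his true order $x_i$, strictly prefers $F(x_i',x_{-i})$ over $F(x_i,x_{-i})$. The manipulation power $M_i(F)$ is the probability that $x_i'$ is a profitable manipulation by voter $i$ at $x$, where $x_1,\dots,x_n,x_i'$ are chosen independently and uniformly at random from $L_m$. All probabilities are with respect to the uniform distribution on profiles. The $i$-th dictatorship is the SCF outputting the top alternative of $x_i$; the distance of $F$ from a dictatorship is $\min_i \Pr_x[F(x)\neq \text{top}(x_i)]$. $F$ is neutral if it commutes with every permutation of the alternatives (permuting alternatives in all voters' orders permutes the output accordingly). *)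

(* Defs.v *)
From HB Require Import structures.
From mathcomp Require Import all_boot all_order all_algebra all_fingroup.
Set Implicit Arguments. Unset Strict Implicit. Unset Printing Implicit Defensive.
Import Order.TTheory GRing.Theory Num.Theory.

(* A linear order on the m alternatives 'I_m is a permutation s : {perm 'I_m};
   s k is the alternative ranked at position k (position 0 = top). *)
Definition lorder (m : nat) := {perm 'I_m}.

Definition prefers m (s : lorder m) (a b : 'I_m) : bool := ((s^-1)%g a < (s^-1)%g b)%N.

Definition top m (s : lorder m.+1) : 'I_m.+1 := s ord0.

Definition profile (n m : nat) := {ffun 'I_n -> lorder m}.

Definition SCF (n m : nat) := profile n m -> 'I_m.

Definition upd n m (x : profile n m) (i : 'I_n) (y : lorder m) : profile n m :=
  [ffun j => if j == i then y else x j].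

Definition Pr (R : numFieldType) (T : finType) (E : pred T) : R :=
  (#|[set t | E t]|)%:R / (#|T|)%:R.

Definition manip_power (R : numFieldType) n m (F : SCF n m) (i : 'I_n) : R :=
  Pr R (fun p : profile n m * lorder m =>
          prefers (p.1 i) (F (upd p.1 i p.2)) (F p.1)).

Definition relabel m (sigma : {perm 'I_m}) (s : lorder m) : lorder m := (s * sigma)%g.

Definition neutral n m (F : SCF n m) : Prop :=
  forall (sigma : {perm 'I_m}) (x : profile n m),
    F [ffun j => relabel sigma (x j)] = sigma (F x).

(* Main.v *)
Require Import Defs.
From HB Require Import structures.
From mathcomp Require Import all_boot all_order all_algebra all_fingroup.
From mathcomp Require Import reals Rstruct sequences exp.
From mathcomp Require Import ring lra zify.
Import Order.TTheory GRing.Theory Num.Theory.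
Local Open Scope ring_scope.
Set Implicit Arguments. Unset Strict Implicit. Unset Printing Implicit Defensive.

   
                                                                            
                                                                      
                                                                             
                                                                               
                                                                                 
                                                                            
                                                                      
                                                                        
                                                                          
          

                                                                              
                                                                                
                                                                            
                                                                               
                                                                              
                                                                                
                                                                                
                                                                             
                                                                             
                                                                         
  

                            

(** Encode an order on three alternatives by three bits: whether 0 beats 1, 1 beats 2, and 2 beats
    0. The six orders are exactly the not-all-equal triples, so a uniform profile is a triple of
    correlated bit strings x, y, z, one per pair of alternatives.

    Fix a pair a, b and let f be the +-1 function of the voters' bits on it that names the likelier
    of the outcomes a and b given these bits. Each voter then has three orders left, forming a chain
    along which the third alternative rises. If the outcome turns into a or b while the third
    alternative rises, one of the two orders can profitably misreport the other. So few
    manipulations make both conditional indicators nearly decreasing, and a robust Harris inequality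
    ([harris]) shows that two disjoint nearly decreasing events cannot both be likely. Hence the
    squared probability that the outcome is the member of the pair rejected by f is at most twice
    the sum of the M_i ([pair_social]).

    Let f, g, h be these functions for the three pairs and N the sum of their error probabilities,
    so that N^2 is at most 18 times the sum of the M_i. When f(x) = g(y) = h(z) the social
    preference is cyclic and every outcome is rejected, so the probability [NT] of a cycle is at
    most N. What remains is a quantitative Arrow theorem. If a mean is at least 3/4 in absolute
    value, an exponential-moment inequality that tensorizes over the voters ([tensor_lower]) gives
    [NT] of order eps^3 ([NT_biased]); squaring produces the sixth power. If all means are central,
    the same inequality bounds [NT] below by a constant unless the means are nearly 0; then a small
    [NT] forces almost all Fourier weight onto level one, and f, g, h nearly follow one common voter
    or that voter's reverse, at distance at most 18 [NT] ([linear_dictator], [balanced_dictator]).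
    Following a voter contradicts the distance hypothesis unless N has order eps; following the
    reverse outputs the voter's bottom alternative, which is manipulable with constant probability
    ([bottom_manip]). For neutral F every outcome has probability 1/3, so the biased case only
    occurs with N at least 1/5, and eps^2 remains.

    Logarithms and exponentials are used over the standard reals; as all probabilities are rational,
    the bound carries over to every real field. *)

(** * Averages over sequences with independent uniform entries *)

Section Average.
Variable R : realFieldType.

(** One list cell per voter, by recursion, so that product inequalities are proved by induction on
    the number of voters; the section at a vote [t] is [fun s => F (t :: s)]. *)
Fixpoint Ex (T : Type) (l : seq T) (n : nat) (F : seq T -> R) : R :=
  if n is m.+1 then (\sum_(t <- l) Ex l m (fun s => F (t :: s))) / (size l)%:R
  else F [::].

Lemma ExS (T : Type) (l : seq T) n F :
  Ex l n.+1 F = (\sum_(t <- l) Ex l n (fun s => F (t :: s))) / (size l)%:R.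
Proof. by []. Qed.

Lemma eq_Ex_in (T : eqType) (l : seq T) n (F G : seq T -> R) :
  (forall s, size s = n -> all (mem l) s -> F s = G s) -> Ex l n F = Ex l n G.
Proof.
elim: n F G => [|n IH] F G FG /=; first exact: FG.
congr (_ / _); apply: eq_big_seq => t tl; apply: IH => s sn sl.
by apply: FG; rewrite /= ?sn // tl.
Qed.

Lemma eq_Ex (T : eqType) (l : seq T) n (F G : seq T -> R) :
  F =1 G -> Ex l n F = Ex l n G.
Proof. by move=> FG; apply: eq_Ex_in. Qed.

Lemma le_Ex_in (T : eqType) (l : seq T) n (F G : seq T -> R) :
  (forall s, size s = n -> all (mem l) s -> F s <= G s) -> Ex l n F <= Ex l n G.
Proof.
elim: n F G => [|n IH] F G FG /=; first exact: FG.
rewrite ler_wpM2r ?invr_ge0 ?ler0n // big_seq [leRHS]big_seq.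
apply: ler_sum => t tl; apply: IH => s sn sl.
by apply: FG; rewrite /= ?sn // tl.
Qed.

Lemma le_Ex (T : eqType) (l : seq T) n (F G : seq T -> R) :
  (forall s, F s <= G s) -> Ex l n F <= Ex l n G.
Proof. by move=> FG; apply: le_Ex_in. Qed.

Lemma ExD (T : eqType) (l : seq T) n (F G : seq T -> R) :
  Ex l n (fun s => F s + G s) = Ex l n F + Ex l n G.
Proof.
elim: n F G => [|n IH] F G //=; rewrite -mulrDl -big_split /=.
by congr (_ / _); apply: eq_bigr => t _; apply: IH.
Qed.

Lemma ExZ (T : eqType) (l : seq T) n c (F : seq T -> R) :
  Ex l n (fun s => c * F s) = c * Ex l n F.
Proof.
elim: n F => [|n IH] F //=; rewrite mulrA mulr_sumr.
by congr (_ / _); apply: eq_bigr => t _; apply: IH.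
Qed.

Lemma ExN (T : eqType) (l : seq T) n (F : seq T -> R) :
  Ex l n (fun s => - F s) = - Ex l n F.
Proof.
by rewrite -mulN1r -ExZ; apply: eq_Ex => s; rewrite mulN1r.
Qed.

Lemma ExB (T : eqType) (l : seq T) n (F G : seq T -> R) :
  Ex l n (fun s => F s - G s) = Ex l n F - Ex l n G.
Proof. by rewrite ExD ExN. Qed.

Lemma Ex_cst (T : eqType) (l : seq T) n (c : R) :
  (0 < size l)%N -> Ex l n (fun=> c) = c.
Proof.
move=> l0; elim: n => //= n ->.
by rewrite big_const_seq count_predT iter_addr_0 -[c *+ _]mulr_natr mulfK // pnatr_eq0 -lt0n.
Qed.

Lemma Ex_ge0 (T : eqType) (l : seq T) n (F : seq T -> R) :
  (forall s, 0 <= F s) -> 0 <= Ex l n F.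
Proof.
elim: n F => [|n IH] F F0 //=.
by rewrite mulr_ge0 ?invr_ge0 ?ler0n // sumr_ge0 // => t _; apply: IH.
Qed.

Lemma Ex_le1 (T : eqType) (l : seq T) n (F : seq T -> R) :
  (0 < size l)%N -> (forall s, F s <= 1) -> Ex l n F <= 1.
Proof. by move=> l0 F1; rewrite -[leRHS](@Ex_cst _ l n) //; apply: le_Ex. Qed.

Lemma Ex_map (T U : Type) (p : T -> U) (l : seq T) n (F : seq U -> R) :
  Ex l n (fun s => F (map p s)) = Ex (map p l) n F.
Proof.
elim: n F => [|n IH] F //=; rewrite big_map size_map; congr (_ / _).
by apply: eq_bigr => t _; rewrite -IH.
Qed.

Lemma Ex_list (T : eqType) (l l' : seq T) n (F : seq T -> R) :
  (forall G : T -> R, (\sum_(t <- l) G t) / (size l)%:R =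
     (\sum_(t <- l') G t) / (size l')%:R) -> Ex l n F = Ex l' n F.
Proof.
move=> ll'; elim: n F => [|n IH] F //=; rewrite -ll'; congr (_ / _).
by apply: eq_bigr => t _; rewrite -IH.
Qed.

Lemma Ex_perm (T : eqType) (l l' : seq T) n (F : seq T -> R) :
  perm_eq l l' -> Ex l n F = Ex l' n F.
Proof.
by move=> ll'; apply: Ex_list => G; rewrite (perm_big _ ll') (perm_size ll').
Qed.

Lemma Ex_sum (T : eqType) (I : Type) (r : seq I) (l : seq T) n (F : I -> seq T -> R) :
  Ex l n (fun s => \sum_(i <- r) F i s) = \sum_(i <- r) Ex l n (F i).
Proof.
elim: r => [|i r IH].
  rewrite big_nil -[RHS](mul0r (Ex l n (fun=> 0))) -ExZ.
  by apply: eq_Ex => s; rewrite big_nil mul0r.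
by rewrite big_cons -IH -ExD; apply: eq_Ex => s; rewrite big_cons.
Qed.

(** When each letter is an independent pair, the two component sequences may be drawn one after the
    other. This is how one conditions on one bit per voter. *)
Lemma Ex_zip (T U V : eqType) (c : T -> U -> V) (l : seq T) (k : seq U) n
    (F : seq V -> R) :
  Ex [seq c t u | t <- l, u <- k] n F =
  Ex l n (fun s => Ex k n (fun v => F [seq c p.1 p.2 | p <- zip s v])).
Proof.
elim: n F => [|n IH] F //=.
rewrite big_allpairs_dep size_allpairs /= mulr_suml [RHS]mulr_suml.
apply: eq_bigr => t _.
rewrite natrM invfM mulrA mulrAC; congr (_ / _).
rewrite mulr_suml; under eq_bigr => u _ do rewrite IH mulrC -ExZ.
rewrite -Ex_sum; apply: eq_Ex => s; rewrite mulr_suml.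
by apply: eq_bigr => u _; rewrite mulrC.
Qed.

Definition ins (T : Type) (i : nat) (t : T) (s : seq T) := take i s ++ t :: drop i s.

Lemma map_ins (T U : Type) (p : T -> U) i t s : map p (ins i t s) = ins i (p t) (map p s).
Proof. by rewrite map_cat /= map_take map_drop. Qed.

Lemma nth_ins (T : Type) (d : T) i t s : (i <= size s)%N -> nth d (ins i t s) i = t.
Proof. by move=> si; rewrite nth_cat size_takel // ltnn subnn. Qed.

Lemma set_nth_ins (T : Type) (d : T) i t u s : (i <= size s)%N ->
  set_nth d (ins i t s) i u = ins i u s.
Proof. by elim: i s => [|i IH] [|v s] //= si; rewrite /ins /= -/(ins i t s) IH. Qed.

Lemma Ex_ins (T : eqType) (l : seq T) i n (F : seq T -> R) : (i <= n)%N ->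
  Ex l n.+1 F = (\sum_(t <- l) Ex l n (fun s => F (ins i t s))) / (size l)%:R.
Proof.
elim: i n F => [|i IH] n F.
  move=> _; rewrite ExS; congr (_ / _); apply: eq_bigr => t _; apply: eq_Ex => s.
  by rewrite /ins take0 drop0.
case: n => // n i_n; rewrite ExS.
have -> : \sum_(t <- l) Ex l n.+1 (fun s => F (t :: s)) =
  (\sum_(t <- l) \sum_(u <- l) Ex l n (fun s => F (t :: ins i u s))) / (size l)%:R.
  by rewrite mulr_suml; apply: eq_bigr => t _; rewrite IH.
have -> : \sum_(t <- l) Ex l n.+1 (fun s => F (ins i.+1 t s)) =
  (\sum_(t <- l) \sum_(u <- l) Ex l n (fun s => F (u :: ins i t s))) / (size l)%:R.
  by rewrite mulr_suml; apply: eq_bigr => t _; rewrite ExS.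
by rewrite exchange_big.
Qed.

Lemma Ex_resample (T : eqType) (d : T) (l : seq T) i n (F : seq T -> R) :
  (0 < size l)%N -> (i < n)%N ->
  Ex l n (fun s => (\sum_(t <- l) F (set_nth d s i t)) / (size l)%:R) = Ex l n F.
Proof.
move=> l0; case: n => // n; rewrite ltnS => i_n; rewrite !(Ex_ins _ _ i_n).
congr (_ / _).
pose X := \sum_(u <- l) Ex l n (fun s => F (ins i u s)).
have E t : Ex l n (fun s => (\sum_(u <- l) F (set_nth d (ins i t s) i u)) / (size l)%:R)
   = X / (size l)%:R.
  rewrite mulrC /X -(Ex_sum l l n (fun u s => F (ins i u s))) -ExZ.
  apply: eq_Ex_in => s sn _; rewrite mulrC; congr (_ * _).
  by apply: eq_bigr => u _; rewrite set_nth_ins ?sn.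
rewrite (eq_bigr _ (fun t _ => E t)) big_const_seq count_predT iter_addr_0.
by rewrite -[_ *+ _]mulr_natr divfK // pnatr_eq0 -lt0n.
Qed.

End Average.

                                                   

                                                                               
                                                                      
(** * Not-all-equal triples and level-one Fourier weight *)

(** [c0] tells whether 0 beats 1, [c1] whether 1 beats 2, [c2] whether 2 beats 0. Transitivity
    excludes just the two constant triples, leaving the six orders of [L6]. *)
Definition code := (bool * bool * bool)%type.
Definition c0 (c : code) : bool := c.1.1.
Definition c1 (c : code) : bool := c.1.2.
Definition c2 (c : code) : bool := c.2.

Definition L6 : seq code :=
  [:: (true, true, false); (true, false, true); (true, false, false);
      (false, true, true); (false, true, false); (false, false, true)].

Definition B2 : seq bool := [:: true; false].

Section NAE.
Variable R : realFieldType.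
Implicit Types f g h : seq bool -> R.

Definition EB n f : R := Ex B2 n f.

Definition E3 n (F : seq bool -> seq bool -> seq bool -> R) : R :=
  Ex L6 n (fun s => F (map c0 s) (map c1 s) (map c2 s)).

Lemma EBS n f : EB n.+1 f =
  (EB n (fun s => f (true :: s)) + EB n (fun s => f (false :: s))) / 2.
Proof. by rewrite /EB ExS !big_cons big_nil addr0. Qed.

Lemma E3S n F : E3 n.+1 F =
  (E3 n (fun x y z => F (true :: x) (true :: y) (false :: z)) +
   E3 n (fun x y z => F (true :: x) (false :: y) (true :: z)) +
   E3 n (fun x y z => F (true :: x) (false :: y) (false :: z)) +
   E3 n (fun x y z => F (false :: x) (true :: y) (true :: z)) +
   E3 n (fun x y z => F (false :: x) (true :: y) (false :: z)) +
   E3 n (fun x y z => F (false :: x) (false :: y) (true :: z))) / 6.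
Proof. by rewrite /E3 ExS !big_cons big_nil /= addr0 !addrA. Qed.

Lemma E3_ins n i F : (i <= n)%N -> E3 n.+1 F =
  (E3 n (fun x y z => F (ins i true x) (ins i true y) (ins i false z)) +
   E3 n (fun x y z => F (ins i true x) (ins i false y) (ins i true z)) +
   E3 n (fun x y z => F (ins i true x) (ins i false y) (ins i false z)) +
   E3 n (fun x y z => F (ins i false x) (ins i true y) (ins i true z)) +
   E3 n (fun x y z => F (ins i false x) (ins i true y) (ins i false z)) +
   E3 n (fun x y z => F (ins i false x) (ins i false y) (ins i true z))) / 6.
Proof.
move=> i_n; rewrite /E3 (Ex_ins _ _ i_n) !big_cons big_nil /= addr0 !addrA.
by congr ((_ + _ + _ + _ + _ + _) / _); apply: eq_Ex => s; rewrite !map_ins.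
Qed.

Lemma EB_ins n i f : (i <= n)%N -> EB n.+1 f =
  (EB n (fun s => f (ins i true s)) + EB n (fun s => f (ins i false s))) / 2.
Proof. by move=> i_n; rewrite /EB (Ex_ins _ _ i_n) !big_cons big_nil addr0. Qed.

Lemma E3_rot n F : E3 n (fun x y z => F y z x) = E3 n F.
Proof.
rewrite /E3 -[RHS](@Ex_perm _ _ (map (fun c : code => (c1 c, c2 c, c0 c)) L6) L6) //.
by rewrite -[RHS]Ex_map; apply: eq_Ex => s; rewrite -!map_comp.
Qed.

Lemma E3_swap n F : E3 n (fun x y z => F y x z) = E3 n F.
Proof.
rewrite /E3 -[RHS](@Ex_perm _ _ (map (fun c : code => (c1 c, c0 c, c2 c)) L6) L6) //.
by rewrite -[RHS]Ex_map; apply: eq_Ex => s; rewrite -!map_comp.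
Qed.

Lemma E3_x n f : E3 n (fun x _ _ => f x) = EB n f.
Proof.
rewrite /E3 /EB Ex_map; apply: Ex_list => G.
by rewrite /= !big_cons !big_nil /c0 /=; field.
Qed.

Lemma E3_y n f : E3 n (fun _ y _ => f y) = EB n f.
Proof. by rewrite -[RHS]E3_x -(E3_rot n (fun x _ _ => f x)). Qed.

Lemma E3_z n f : E3 n (fun _ _ z => f z) = EB n f.
Proof. by rewrite -[RHS]E3_y -(E3_rot n (fun _ y _ => f y)). Qed.

Lemma E3D n F G : E3 n (fun x y z => F x y z + G x y z) = E3 n F + E3 n G.
Proof. by rewrite /E3 -ExD. Qed.

Lemma E3B n F G : E3 n (fun x y z => F x y z - G x y z) = E3 n F - E3 n G.
Proof. by rewrite /E3 -ExB. Qed.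

Lemma E3Z n c F : E3 n (fun x y z => c * F x y z) = c * E3 n F.
Proof. by rewrite /E3 -ExZ. Qed.

Lemma eq_E3 n F G : (forall x y z, F x y z = G x y z) -> E3 n F = E3 n G.
Proof. by move=> FG; apply: eq_Ex => s; apply: FG. Qed.

Lemma le_E3 n F G : (forall x y z, F x y z <= G x y z) -> E3 n F <= E3 n G.
Proof. by move=> FG; apply: le_Ex => s; apply: FG. Qed.

Lemma eq_EB n f g : f =1 g -> EB n f = EB n g.
Proof. exact: eq_Ex. Qed.

Lemma EBD n f g : EB n (fun s => f s + g s) = EB n f + EB n g.
Proof. exact: ExD. Qed.

Lemma EBZ n c f : EB n (fun s => c * f s) = c * EB n f.
Proof. exact: ExZ. Qed.

Lemma EBB n f g : EB n (fun s => f s - g s) = EB n f - EB n g.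
Proof. exact: ExB. Qed.

Lemma EBN n f : EB n (fun s => - f s) = - EB n f.
Proof. exact: ExN. Qed.

Lemma EB_cst n (c : R) : EB n (fun=> c) = c.
Proof. exact: Ex_cst. Qed.

Lemma le_EB n f g : (forall s, f s <= g s) -> EB n f <= EB n g.
Proof. exact: le_Ex. Qed.

Definition Var n f := EB n (fun s => f s ^+ 2) - EB n f ^+ 2.

Lemma Var_ge0 n f : 0 <= Var n f.
Proof.
have : 0 <= EB n (fun s => (f s - EB n f) ^+ 2).
  by apply: Ex_ge0 => s; rewrite sqr_ge0.
rewrite (@eq_EB _ _ (fun s => f s ^+ 2 + ((- 2 * EB n f) * f s + EB n f ^+ 2))); last first.
  by move=> s; ring.
rewrite EBD EBD EBZ EB_cst /Var; lra.
Qed.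

(** Two bits of a uniform not-all-equal triple have correlation -1/3, so a covariance is at least
    -1/3 times the product of the standard deviations, and AM-GM gives 1/6 of the sum of
    variances. *)
Lemma E3_gap n f g :
  EB n f * EB n g - (Var n f + Var n g) / 6 <= E3 n (fun x y _ => f x * g y).
Proof.
elim: n f g => [|n IH] f g; first by rewrite /EB /E3 /Var /EB /=; lra.
rewrite E3S /Var !EBS.
have := IH (fun x => f (true :: x)) (fun y => g (true :: y)).
have := IH (fun x => f (true :: x)) (fun y => g (false :: y)).
have := IH (fun x => f (false :: x)) (fun y => g (true :: y)).
have := IH (fun x => f (false :: x)) (fun y => g (false :: y)).
rewrite /Var.
move: (E3 _ _) (E3 _ _) (E3 _ _) (E3 _ _) => e1 e2 e3 e4.
move: (EB n _) (EB n _) (EB n _) (EB n _) => a1 a2 a3 a4.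
move: (EB n _) (EB n _) (EB n _) (EB n _) => b1 b2 b3 b4 *.
have := sqr_ge0 ((b2 - a4) - (b4 - a3)); lra.
Qed.

(** Together with [hdiff], the Fourier decomposition in the first bit: f is [avgf f] plus the sign
    of that bit times [hdiff f]. *)
Definition avgf f (s : seq bool) := (f (true :: s) + f (false :: s)) / 2.
Definition hdiff f (s : seq bool) := (f (true :: s) - f (false :: s)) / 2.

Lemma EB_avgf n f : EB n.+1 f = EB n (avgf f).
Proof. by rewrite EBS -EBD mulrC -EBZ; apply: eq_EB => s; rewrite mulrC. Qed.

Lemma Var_avgf n f : Var n.+1 f = Var n (avgf f) + EB n (fun s => hdiff f s ^+ 2).
Proof.
rewrite /Var !EB_avgf addrAC -EBD; congr (_ - _).
by apply: eq_EB => s; rewrite /avgf /hdiff; field.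
Qed.

Lemma E3_avgf n f g : E3 n.+1 (fun x y _ => f x * g y) =
  E3 n (fun x y _ => avgf f x * avgf g y) - E3 n (fun x y _ => hdiff f x * hdiff g y) / 3.
Proof.
rewrite E3S [X in _ - X]mulrC -E3Z -E3B -!E3D [LHS]mulrC -E3Z.
by apply: eq_E3 => x y z; rewrite /avgf /hdiff; field.
Qed.

                                                 
(** The level-one Fourier coefficients (see [coefsE]), found by averaging out the earlier bits. *)
Fixpoint coefs n f : seq R :=
  if n is m.+1 then EB m (hdiff f) :: coefs m (avgf f) else [::].

Definition sumX k (a : seq R) := \sum_(x <- a) x ^+ k.

Lemma sumX_cons k x a : sumX k (x :: a) = x ^+ k + sumX k a.
Proof. by rewrite /sumX big_cons. Qed.

Lemma sumX_nil k : sumX k [::] = 0.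
Proof. by rewrite /sumX big_nil. Qed.

Definition W1 n f := sumX 2 (coefs n f).

Lemma W1S n f : W1 n.+1 f = EB n (hdiff f) ^+ 2 + W1 n (avgf f).
Proof. exact: sumX_cons. Qed.

(** Level one is damped by 1/3 but higher levels by at most 1/9. In the induction [hdiff] already
    carries a factor 1/3; its mean is a level-one coefficient, and its variance, of higher level,
    gains another 1/3 from [E3_gap]. *)
Lemma E3_level n f g :
  EB n f * EB n g - (W1 n f + W1 n g) / 6 -
    ((Var n f - W1 n f) + (Var n g - W1 n g)) / 18
  <= E3 n (fun x y _ => f x * g y).
Proof.
elim: n f g => [|n IH] f g.
  by rewrite /EB /E3 /W1 /Var /EB /= sumX_nil; lra.
rewrite E3_avgf !EB_avgf !Var_avgf !W1S.
have := IH (avgf f) (avgf g).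
have := E3_gap n (hdiff f) (fun s => - hdiff g s).
have -> : E3 n (fun x y _ => hdiff f x * - hdiff g y) =
  - E3 n (fun x y _ => hdiff f x * hdiff g y).
  by rewrite -mulN1r -E3Z; apply: eq_E3 => x y z; rewrite mulN1r mulrN.
have -> : Var n (fun s => - hdiff g s) = Var n (hdiff g).
  rewrite /Var (@eq_EB _ _ (fun s => hdiff g s ^+ 2)) => [|s]; last by rewrite sqrrN.
  by rewrite EBN sqrrN.
rewrite EBN /Var.
have := sqr_ge0 (EB n (hdiff f) - EB n (hdiff g)).
lra.
Qed.

Definition sgn (b : bool) : R := if b then 1 else -1.
Definition bcoord i (s : seq bool) := sgn (nth false s i).

Fixpoint lin (a : seq R) (s : seq bool) : R :=
  if a is x :: a' then if s is b :: s' then sgn b * x + lin a' s' else 0 else 0.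

Lemma EB_lin n f : EB n (fun s => f s * lin (coefs n f) s) = W1 n f.
Proof.
suff H a : size a = n -> EB n (fun s => f s * lin a s) =
    \sum_(p <- zip a (coefs n f)) p.1 * p.2.
  rewrite H ?/W1 /sumX; last by elim: n f {H} => //= n IH f; rewrite IH.
  by elim: (coefs n f) => [|x a IH] /=; rewrite ?big_nil // !big_cons IH expr2.
elim: n f a => [|n IH] f [|x a] //=.
  by move=> _; rewrite big_nil /EB /= mulr0.
move=> [sa]; rewrite big_cons /= -IH // EB_avgf -EBZ -EBD.
by apply: eq_EB => s; rewrite /avgf /hdiff /=; field.
Qed.

Lemma coefsE n f i : (i < n)%N -> EB n (fun s => f s * bcoord i s) = nth 0 (coefs n f) i.
Proof.
elim: n f i => [|n IH] f [|i] // i_n.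
  by rewrite EB_avgf; apply: eq_EB => s; rewrite /avgf /hdiff /bcoord /=; field.
rewrite /= -IH // EB_avgf.
by apply: eq_EB => s; rewrite /avgf /bcoord /=; field.
Qed.

Lemma EB_lin2 n a : size a = n -> EB n (fun s => lin a s ^+ 2) = sumX 2 a.
Proof.
elim: n a => [|n IH] [|x a] //.
  by rewrite sumX_nil /EB /= expr2 mulr0.
move=> [sa].
rewrite sumX_cons -(IH a sa) EB_avgf -[x ^+ 2](EB_cst n) -EBD.
by apply: eq_EB => s; rewrite /avgf /=; field.
Qed.

Lemma EB_lin4 n a : size a = n ->
  EB n (fun s => lin a s ^+ 4) = 3 * sumX 2 a ^+ 2 - 2 * sumX 4 a.
Proof.
elim: n a => [|n IH] [|x a] //.
  by move=> _; rewrite !sumX_nil /EB /=; ring.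
move=> [sa].
rewrite !sumX_cons EB_avgf.
rewrite (@eq_EB _ _ (fun s => lin a s ^+ 4 + (6 * x ^+ 2 * lin a s ^+ 2 + x ^+ 4))).
  by rewrite !EBD EBZ EB_cst IH // EB_lin2 //; ring.
by move=> s; rewrite /avgf /=; field.
Qed.

Lemma sumX2_ge0 a : 0 <= sumX 2 a.
Proof. by apply: sumr_ge0 => x _; rewrite sqr_ge0. Qed.

Lemma sumX4_ge0 a : 0 <= sumX 4 a.
Proof. by apply: sumr_ge0 => x _; rewrite (exprM x 2 2) sqr_ge0. Qed.

(** Khintchine's inequality for the sixth moment, with the Gaussian constant 15. *)
Lemma EB_lin6 n a : size a = n ->
  EB n (fun s => lin a s ^+ 6) <= 15 * sumX 2 a ^+ 3.
Proof.
elim: n a => [|n IH] [|x a] //.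
  by move=> _; rewrite !sumX_nil /EB /=; lra.
move=> [sa].
rewrite !sumX_cons EB_avgf.
rewrite (@eq_EB _ _ (fun s => lin a s ^+ 6 + (15 * x ^+ 2 * lin a s ^+ 4 +
   (15 * x ^+ 4 * lin a s ^+ 2 + x ^+ 6)))); last first.
  by move=> s; rewrite /avgf /=; field.
rewrite !EBD !EBZ EB_cst EB_lin2 // EB_lin4 //.
have := IH a sa; have := sumX2_ge0 a; have := sumX4_ge0 a.
move: (EB n _) (sumX 2 a) (sumX 4 a) => e w q q0 w0 ew.
have x2 : 0 <= x ^+ 2 by rewrite sqr_ge0.
have : 0 <= x ^+ 2 * q by apply: mulr_ge0.
have : 0 <= x ^+ 2 * x ^+ 2 * w by rewrite mulr_ge0 // mulr_ge0.
have : 0 <= x ^+ 2 * x ^+ 2 * x ^+ 2 by rewrite mulr_ge0 // mulr_ge0.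
lra.
Qed.

Lemma max_coef (a : seq R) : a != [::] ->
  exists2 i, (i < size a)%N & sumX 4 a <= (nth 0 a i) ^+ 2 * sumX 2 a.
Proof.
case: a => // x a _; elim: a x => [|y a IH] x.
  by exists 0%N => //=; rewrite !sumX_cons !sumX_nil; lra.
have [i i_a Hi] := IH y; rewrite (sumX_cons 4) (sumX_cons 2).
have s2 := sumX2_ge0 (y :: a).
set m := nth 0 (y :: a) i in Hi.
case: (lerP (m ^+ 2) (x ^+ 2)) => mx.
  exists 0%N => //=; have := ler_wpM2r s2 mx.
  lra.
exists i.+1 => //=; rewrite -/m.
have := ler_wpM2r (sqr_ge0 x) (ltW mx); lra.
Qed.

End NAE.

(** * Boolean functions that are nearly linear *)

Section Dictator.
Variable R : realFieldType.
Implicit Types f g h : seq bool -> R.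

Definition pm f := forall s, f s = 1 \/ f s = -1.

Lemma pm_sqr f : pm f -> forall s, f s ^+ 2 = 1.
Proof. by move=> pf s; case: (pf s) => ->; rewrite ?sqrrN expr1n. Qed.

Lemma pm_Var n f : pm f -> Var n f = 1 - EB n f ^+ 2.
Proof.
by move=> pf; rewrite /Var (@eq_EB _ _ _ (fun=> 1)) ?EB_cst // => s; exact: pm_sqr.
Qed.

Lemma pm_EB_le n f : pm f -> -1 <= EB n f <= 1.
Proof.
move=> pf; apply/andP; split.
  by rewrite -[leLHS](@EB_cst R n); apply: le_EB => s; case: (pf s) => ->; lra.
by rewrite -[leRHS](@EB_cst R n); apply: le_EB => s; case: (pf s) => ->; lra.
Qed.

Lemma sgnP b : @sgn R b = 1 \/ @sgn R b = -1.
Proof. by case: b; [left|right]. Qed.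

Lemma pm_mul f g : pm f -> pm g -> pm (fun s => f s * g s).
Proof.
by move=> pf pg s; case: (pf s) => ->; case: (pg s) => ->;
  rewrite ?mulN1r ?mul1r ?opprK; [left|right|right|left].
Qed.

Lemma pm_opp f : pm f -> pm (fun s => - f s).
Proof. by move=> pf s; case: (pf s) => ->; rewrite ?opprK; [right|left]. Qed.

Lemma pm_bcoord i : pm (@bcoord R i).
Proof. by move=> s; apply: sgnP. Qed.

Lemma pm_sgn b : pm (fun=> sgn R b).
Proof. by move=> s; apply: sgnP. Qed.

Lemma size_coefs n f : size (coefs n f) = n.
Proof. by elim: n f => //= n IH f; rewrite IH. Qed.

Lemma norm_sub_lin n f : pm f ->
  EB n (fun s => (f s - lin (coefs n f) s) ^+ 2) = 1 - W1 n f.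
Proof.
move=> pf.
rewrite (@eq_EB _ _ _ (fun s => 1 - 2 * (f s * lin (coefs n f) s) + lin (coefs n f) s ^+ 2)).
  by rewrite EBD EBB EBZ EB_cst EB_lin (EB_lin2 (size_coefs n f)) /W1; ring.
by move=> s; have := pm_sqr pf s; lra.
Qed.

Lemma W1_le1 n f : pm f -> W1 n f <= 1.
Proof.
move=> pf; rewrite -subr_ge0 -norm_sub_lin //.
by apply: Ex_ge0 => s; exact: sqr_ge0.
Qed.

                                                                           
                                                                             
                                                                             
                                                
(** If f is close to its linear part l, then l^2 is close to 1 in mean square. The exact fourth
    moment of a linear form turns this into a lower bound on the sum of fourth powers of the
    coefficients, so one coefficient has square at least 11/12. Being at most 1 in absolute value,
    it is at least 11/12 in absolute value too. *)
Lemma linear_dictator n f : pm f -> 1 - W1 n f <= 1 / 40 / 100 ->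
  exists i b, (i < n)%N /\ 11 / 12 <= EB n (fun s => (sgn R b * bcoord R i s) * f s).
Proof.
move=> pf W; set a := coefs n f; set l := lin a.
have sa : size a = n := size_coefs n f.
have El2 : EB n (fun s => l s ^+ 2) = W1 n f := EB_lin2 sa.
have El4 : EB n (fun s => l s ^+ 4) = 3 * W1 n f ^+ 2 - 2 * sumX 4 a := EB_lin4 sa.
have El6 : EB n (fun s => l s ^+ 6) <= 15 * W1 n f ^+ 3 := EB_lin6 sa.
have Edl : EB n (fun s => (f s - l s) ^+ 2) = 1 - W1 n f := norm_sub_lin n pf.
have W_le1 := W1_le1 n pf.
have Eq : EB n (fun s => (l s ^+ 2 - 1) ^+ 2) <=
    441 * (1 - W1 n f) + (15 * W1 n f ^+ 3) / 400.
  apply: (@le_trans _ _ (EB n (fun s => 441 * (f s - l s) ^+ 2 + 400^-1 * l s ^+ 6))).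
    apply: le_EB => s; set t := l s.
    have t2 : 0 <= t ^+ 2 := sqr_ge0 t.
    (* For |t| <= 20 factor (t^2 - 1)^2 = (t - f)^2 (t + f)^2 with |t + f| <= 21; for larger |t| the
       term t^6 / 400 dominates t^4. *)
    case: (lerP (t ^+ 2) 400) => tK.
      have tl : -20 <= t <= 20.
        by rewrite -ler_norml -(@ler_pXn2r _ 2) ?nnegrE // real_normK ?num_real; lra.
      have t6 : 0 <= t ^+ 6 by rewrite (exprM t 2 3) exprn_ge0.
      case: (pf s) => ->.
        have : 0 <= (441 - (t + 1) ^+ 2) * (t - 1) ^+ 2.
          rewrite mulr_ge0 ?sqr_ge0 // subr_ge0.
          have -> : 441 = 21 ^+ 2 :> R by ring.
          by rewrite -(real_normK (num_real (t + 1))) ler_pXn2r ?nnegrE // ler_norml; lra.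
        lra.
      have : 0 <= (441 - (t - 1) ^+ 2) * (t + 1) ^+ 2.
        rewrite mulr_ge0 ?sqr_ge0 // subr_ge0.
        have -> : 441 = 21 ^+ 2 :> R by ring.
        by rewrite -(real_normK (num_real (t - 1))) ler_pXn2r ?nnegrE // ler_norml; lra.
      lra.
    have : 0 <= (t ^+ 2 - 400) * (t ^+ 2 * t ^+ 2).
      by apply: mulr_ge0; [lra | exact: mulr_ge0].
    have := sqr_ge0 (f s - t).
    lra.
  by rewrite EBD !EBZ Edl; lra.
have Eq' : EB n (fun s => (l s ^+ 2 - 1) ^+ 2) =
    3 * W1 n f ^+ 2 - 2 * sumX 4 a - 2 * W1 n f + 1.
  rewrite (@eq_EB _ _ _ (fun s => l s ^+ 4 - 2 * l s ^+ 2 + 1)).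
    by rewrite EBD EBB EBZ EB_cst El4 El2.
  by move=> s; ring.
have W3 : W1 n f ^+ 3 <= 1.
  by rewrite exprn_ile1 //; lra.
have W2 := sqr_ge0 (1 - W1 n f).
have a4 : 11 / 12 <= sumX 4 a by lra.
have a0 : a != [::] by apply/eqP => a_nil; move: a4; rewrite a_nil sumX_nil; lra.
have [i i_a ai] := max_coef a0; rewrite sa in i_a.
have Wa : sumX 2 a <= 1 := W_le1.
have ai2 : 11 / 12 <= nth 0 a i ^+ 2.
  have := ler_wpM2l (sqr_ge0 (nth 0 a i)) Wa; lra.
have aiE := coefsE f i_a; rewrite -/a in aiE.
have pfc : pm (fun s => f s * bcoord R i s) by apply: pm_mul => //; exact: pm_bcoord.
have := pm_EB_le n pfc; rewrite aiE => /andP[ai_ge ai_le].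
exists i; case: (lerP 0 (nth 0 a i)) => ai0.
  exists true; split=> //.
  rewrite (@eq_EB _ _ _ (fun s => f s * bcoord R i s)); last by move=> s /=; ring.
  by rewrite aiE; have := mulr_ge0 ai0 (_ : 0 <= 1 - nth 0 a i); lra.
exists false; split=> //.
rewrite (@eq_EB _ _ _ (fun s => -1 * (f s * bcoord R i s))); last by move=> s /=; ring.
rewrite EBZ aiE; have := mulr_ge0 (_ : 0 <= - nth 0 a i) (_ : 0 <= 1 + nth 0 a i); lra.
Qed.

End Dictator.

                                  

(** * Cycles when the three means are nearly zero *)

Section NearDictator.
Variable R : realFieldType.
Implicit Types f g h : seq bool -> R.

Definition C2 n f g := E3 n (fun x y _ => f x * g y).

Lemma C2C n f g : C2 n f g = C2 n g f.
Proof.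
by rewrite /C2 -(E3_swap n (fun x y _ => g x * f y)); apply: eq_E3 => x y z; rewrite mulrC.
Qed.

                                                                         
(** For +-1 functions the averaged expression is 1 if f x = g y = h z and 0 otherwise: the
    probability of a cyclic social preference. *)
Definition NT n f g h : R :=
  E3 n (fun x y z => (1 + f x * g y + g y * h z + h z * f x) / 4).

Lemma E3_cst n (c : R) : E3 n (fun _ _ _ => c) = c.
Proof. exact: Ex_cst. Qed.

Lemma E3_yz n f g : E3 n (fun x y z => f y * g z) = C2 n f g.
Proof. by rewrite (E3_rot n (fun x y _ => f x * g y)). Qed.

Lemma E3_zx n f g : E3 n (fun x y z => f z * g x) = C2 n f g.
Proof. by rewrite (E3_rot n (fun x y z => f y * g z)) E3_yz. Qed.

Lemma NTE n f g h : NT n f g h = (1 + C2 n f g + C2 n g h + C2 n h f) / 4.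
Proof.
rewrite /NT (@eq_E3 _ _ _ (fun x y z => 4^-1 * (1 + f x * g y + g y * h z + h z * f x))).
  by rewrite E3Z !E3D E3_yz E3_zx E3_cst mulrC.
by move=> x y z; rewrite mulrC.
Qed.

Lemma NT_sgn n b f g h :
  NT n (fun s => sgn R b * f s) (fun s => sgn R b * g s) (fun s => sgn R b * h s) =
  NT n f g h.
Proof. by apply: eq_E3 => x y z; case: b; rewrite /sgn; ring. Qed.

Lemma C2_ge n f g : pm f -> pm g ->
  EB n f * EB n g - (2 - EB n f ^+ 2 - EB n g ^+ 2) / 6 <= C2 n f g.
Proof.
by move=> pf pg; have := E3_gap n f g; rewrite !pm_Var // -/(C2 n f g); lra.
Qed.

Lemma C2_trivial n f g b : pm f -> pm g ->
  sgn R b * EB n f + sgn R b * EB n g - 1 <= C2 n f g.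
Proof.
move=> pf pg; rewrite -(E3_x n f) -(E3_y n g) -!E3Z -E3D -[X in _ - X](E3_cst n) -E3B.
apply: le_E3 => x y z.
by case: (pf x) => ->; case: (pg y) => ->; case: b; rewrite /sgn; lra.
Qed.

                                                                             
(** The case of one voter's vote held fixed, where g is the odd one out. The two pairs containing g
    use the variance bound [C2_ge], the agreeing pair the trivial bound. The error of the odd
    function counts with weight 1, the two others with weight -1/3. *)
Lemma section_NT n b f g h : pm f -> pm g -> pm h ->
  5 / 6 <= sgn R b * EB n f ->
  5 / 6 <= - (sgn R b * EB n g) ->
  5 / 6 <= sgn R b * EB n h ->
  (1 + sgn R b * EB n g) -
    ((1 - sgn R b * EB n f) + (1 - sgn R b * EB n h)) / 3
  <= 1 + C2 n f g + C2 n g h + C2 n h f.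
Proof.
move=> pf pg ph uf ug uh.
have := C2_trivial n b ph pf.
have := C2_ge n pf pg; have := C2_ge n pg ph.
have := pm_EB_le n pf; have := pm_EB_le n pg; have := pm_EB_le n ph.
move: uf ug uh; move: (C2 _ _ _) (C2 _ _ _) (C2 _ _ _) => c1 c2 c3.
move: (EB n f) (EB n g) (EB n h) => F G H.
case: (sgnP R b) => ->; rewrite ?mul1r ?mulN1r.
  move=> uf ug uh /andP[H1 H2] /andP[G1 G2] /andP[F1 F2].
  have : 0 <= (1 + G) * (F + H - 5 / 3) by apply: mulr_ge0; lra.
  have := sqr_ge0 (1 - F); have := sqr_ge0 (1 + G); have := sqr_ge0 (1 - H).
  lra.
move=> uf ug uh /andP[H1 H2] /andP[G1 G2] /andP[F1 F2].
have : 0 <= (1 - G) * (- F - H - 5 / 3) by apply: mulr_ge0; lra.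
have := sqr_ge0 (1 + F); have := sqr_ge0 (1 - G); have := sqr_ge0 (1 + H).
lra.
Qed.

(** Split on voter i. Each of the six sections is the odd one in one of its three triples and agrees
    in the other two, so its error keeps net weight 1 - 2/3 = 1/3; summing the six triples gives the
    factor 18. Correlation 11/12 overall forces 5/6 in each section, as neither exceeds 1. *)
Lemma near_dictator_plus n i f g h : (i <= n)%N -> pm f -> pm g -> pm h ->
  11 / 12 <= EB n.+1 (fun s => bcoord R i s * f s) ->
  11 / 12 <= EB n.+1 (fun s => bcoord R i s * g s) ->
  11 / 12 <= EB n.+1 (fun s => bcoord R i s * h s) ->
  (1 - EB n.+1 (fun s => bcoord R i s * f s)) / 2 +
  (1 - EB n.+1 (fun s => bcoord R i s * g s)) / 2 +
  (1 - EB n.+1 (fun s => bcoord R i s * h s)) / 2 <= 18 * NT n.+1 f g h.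
Proof.
move=> i_n pf pg ph.
pose sec (f : seq bool -> R) b := fun s => f (ins i b s).
have secE k : EB n.+1 (fun s => bcoord R i s * k s) =
    (EB n (sec k true) - EB n (sec k false)) / 2.
  rewrite (EB_ins _ i_n) -EBB -EBD; congr (_ / _).
  by apply: eq_Ex_in => s sn _; rewrite /bcoord !nth_ins ?sn //= /sec; ring.
have psec k b : pm k -> pm (sec k b) by move=> pk s; apply: pk.
have secNT : NT n.+1 f g h = (
    NT n (sec f true) (sec g true) (sec h false) +
    NT n (sec f true) (sec g false) (sec h true) +
    NT n (sec f true) (sec g false) (sec h false) +
    NT n (sec f false) (sec g true) (sec h true) +
    NT n (sec f false) (sec g true) (sec h false) +
    NT n (sec f false) (sec g false) (sec h true)) / 6.
  by rewrite /NT (E3_ins _ i_n).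
have Hodd b f' g' h' := @section_NT n b f' g' h'.
rewrite !secE secNT !NTE.
have bd k b : pm k -> -1 <= EB n (sec k b) <= 1 by move=> pk; apply: pm_EB_le; exact: psec.
move: (bd f true pf) (bd f false pf) (bd g true pg) (bd g false pg)
      (bd h true ph) (bd h false ph)
  => /andP[? ?] /andP[? ?] /andP[? ?] /andP[? ?] /andP[? ?] /andP[? ?] *.
have := Hodd true (sec g true) (sec h false) (sec f true) (psec _ _ pg) (psec _ _ ph) (psec _ _ pf).
have := Hodd true (sec f true) (sec g false) (sec h true) (psec _ _ pf) (psec _ _ pg) (psec _ _ ph).
have := Hodd false (sec h false) (sec f true) (sec g false) (psec _ _ ph) (psec _ _ pf) (psec _ _ pg).
have := Hodd true (sec h true) (sec f false) (sec g true) (psec _ _ ph) (psec _ _ pf) (psec _ _ pg).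
have := Hodd false (sec f false) (sec g true) (sec h false) (psec _ _ pf) (psec _ _ pg) (psec _ _ ph).
have := Hodd false (sec g false) (sec h true) (sec f false) (psec _ _ pg) (psec _ _ ph) (psec _ _ pf).
rewrite /sgn !mul1r !mulN1r.
lra.
Qed.

(** Total distance of f, g, h from the dictator i ([b] true) or its reverse ([b] false). *)
Definition dist3 n i b f g h : R :=
  (1 - EB n (fun s => sgn R b * bcoord R i s * f s)) / 2 +
  (1 - EB n (fun s => sgn R b * bcoord R i s * g s)) / 2 +
  (1 - EB n (fun s => sgn R b * bcoord R i s * h s)) / 2.

Lemma near_dictator n i b f g h : (i < n)%N -> pm f -> pm g -> pm h ->
  11 / 12 <= EB n (fun s => sgn R b * bcoord R i s * f s) ->
  11 / 12 <= EB n (fun s => sgn R b * bcoord R i s * g s) ->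
  11 / 12 <= EB n (fun s => sgn R b * bcoord R i s * h s) ->
  dist3 n i b f g h <= 18 * NT n f g h.
Proof.
case: n => // n i_n pf pg ph; rewrite -(NT_sgn _ b).
have E k : EB n.+1 (fun s => sgn R b * bcoord R i s * k s) =
  EB n.+1 (fun s => bcoord R i s * (sgn R b * k s)) by apply: eq_EB => s; ring.
rewrite /dist3 !E; apply: near_dictator_plus => //.
- exact: (pm_mul (pm_sgn R b) pf).
- exact: (pm_mul (pm_sgn R b) pg).
- exact: (pm_mul (pm_sgn R b) ph).
Qed.

Lemma C2_0l n f g : (forall s, f s = 0) -> C2 n f g = 0.
Proof.
move=> f0; rewrite -[RHS](@E3_cst n); apply: eq_E3 => x y z.
by rewrite f0 mul0r.
Qed.

Lemma avgf_bcoord0 s : avgf (bcoord R 0) s = 0.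
Proof. by rewrite /avgf /bcoord /=; field. Qed.

Lemma hdiff_bcoord0 s : hdiff (bcoord R 0) s = 1.
Proof. by rewrite /hdiff /bcoord /=; field. Qed.

Lemma avgf_bcoordS i s : avgf (bcoord R i.+1) s = bcoord R i s.
Proof. by rewrite /avgf /bcoord /=; field. Qed.

Lemma hdiff_bcoordS i s : hdiff (bcoord R i.+1) s = 0.
Proof. by rewrite /hdiff /bcoord /=; field. Qed.

Lemma C2_bcoord n i j : (i < n)%N -> (j < n)%N ->
  C2 n (bcoord R i) (bcoord R j) = if i == j then - (1 / 3) else 0.
Proof.
elim: n i j => // n IH [|i] [|j] i_n j_n; rewrite {1}/C2 E3_avgf -!/(C2 _ _ _).
- rewrite C2_0l; last exact: avgf_bcoord0.
  rewrite /C2 (@eq_E3 _ _ _ (fun _ _ _ => 1)) ?E3_cst ?sub0r //.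
  by move=> x y z; rewrite !hdiff_bcoord0 mul1r.
- rewrite C2_0l; last exact: avgf_bcoord0.
  by rewrite C2C C2_0l ?mul0r ?subr0 //; exact: hdiff_bcoordS.
- rewrite C2C C2_0l; last exact: avgf_bcoord0.
  by rewrite C2_0l ?mul0r ?subr0 //; exact: hdiff_bcoordS.
- rewrite [X in _ - X / 3]C2_0l; last exact: hdiff_bcoordS.
  rewrite mul0r subr0 eqSS -IH //.
  by apply: eq_E3 => x y z; rewrite !avgf_bcoordS.
Qed.

Lemma C2_approx n f g d : pm f -> pm g -> pm d ->
  C2 n d g - (1 - EB n (fun s => d s * f s)) <= C2 n f g.
Proof.
move=> pf pg pd.
rewrite -(E3_x n) -[X in _ - (X - _)](E3_cst n) -!E3B.
apply: le_E3 => x y z.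
by case: (pf x) => ->; case: (pg y) => ->; case: (pd x) => ->; lra.
Qed.

(** Distinct signed coordinates have correlation 0 or 1/3, never -1/3, and replacing each by its
    approximation costs at most 1/12. *)
Lemma C2_distinct n i b j b' f g : (i < n)%N -> (j < n)%N -> pm f -> pm g ->
  11 / 12 <= EB n (fun s => sgn R b * bcoord R i s * f s) ->
  11 / 12 <= EB n (fun s => sgn R b' * bcoord R j s * g s) ->
  (i, b) != (j, b') -> - (1 / 6) <= C2 n f g.
Proof.
move=> i_n j_n pf pg Ef Eg ij.
have pd c k : pm (fun s => sgn R c * bcoord R k s).
  by apply: (pm_mul (pm_sgn R c)); exact: pm_bcoord.
have := C2_approx n pf pg (pd b i).
have := C2_approx n pg (pd b i) (pd b' j); rewrite C2C [C2 n g _]C2C.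
have -> : C2 n (fun s => sgn R b * bcoord R i s) (fun s => sgn R b' * bcoord R j s) =
    sgn R b * sgn R b' * C2 n (bcoord R i) (bcoord R j).
  by rewrite /C2 -E3Z; apply: eq_E3 => x y z; ring.
rewrite C2_bcoord //; move: ij; rewrite xpair_eqE.
case: (i == j) => /= ij; last by lra.
by case: b b' ij {Ef Eg pd} (Ef) (Eg) => [] [] // _ Ef Eg; rewrite /sgn; lra.
Qed.

(** A tiny [NT] needs the three correlations to sum to nearly -1. By [E3_level] that is possible
    only if nearly all weight is on level one, so each function is near a signed coordinate. *)
Lemma balanced_dictator n f g h : pm f -> pm g -> pm h ->
  -3 / 1000 <= EB n f <= 3 / 1000 -> -3 / 1000 <= EB n g <= 3 / 1000 ->
  -3 / 1000 <= EB n h <= 3 / 1000 -> NT n f g h <= 1 / 1000 / 1000 ->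
  exists i b, (i < n)%N /\ dist3 n i b f g h <= 18 * NT n f g h.
Proof.
move=> pf pg ph /andP[f1 f2] /andP[g1 g2] /andP[h1 h2] small.
have Lfg := E3_level n f g; have Lgh := E3_level n g h; have Lhf := E3_level n h f.
rewrite -!/(C2 _ _ _) !pm_Var // in Lfg Lgh Lhf.
have nt : 4 * NT n f g h = 1 + C2 n f g + C2 n g h + C2 n h f by rewrite NTE; field.
have Wf := W1_le1 n pf; have Wg := W1_le1 n pg; have Wh := W1_le1 n ph.
have sq (p : R) : -3 / 1000 <= p -> p <= 3 / 1000 -> p ^+ 2 <= 9 / 1000 / 1000.
  clear => p1 p2; have : 0 <= (3 / 1000 - p) * (p + 3 / 1000) by apply: mulr_ge0; lra.
  lra.
have f3 := sq _ f1 f2; have g3 := sq _ g1 g2; have h3 := sq _ h1 h2.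
have F2 := sqr_ge0 (EB n f); have G2 := sqr_ge0 (EB n g); have H2 := sqr_ge0 (EB n h).
have fg := sqr_ge0 (EB n f + EB n g); have gh := sqr_ge0 (EB n g + EB n h).
have hf := sqr_ge0 (EB n h + EB n f).
have tot : (1 - W1 n f) + (1 - W1 n g) + (1 - W1 n h) <= 1 / 40 / 100.
  move: Lfg Lgh Lhf nt small f3 g3 h3 F2 G2 H2 fg gh hf; clear; lra.
have Gfg : - (1 / 3 + 1 / 100) <= C2 n f g.
  by have := C2_ge n pf pg; move: f3 g3 F2 G2 fg; clear; lra.
have Ggh : - (1 / 3 + 1 / 100) <= C2 n g h.
  by have := C2_ge n pg ph; move: g3 h3 G2 H2 gh; clear; lra.
have Ghf : - (1 / 3 + 1 / 100) <= C2 n h f.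
  by have := C2_ge n ph pf; move: h3 f3 F2 H2 hf; clear; lra.
have [i [b [i_n fi]]] : exists i b, (i < n)%N /\ 11 / 12 <= EB n (fun s => (sgn R b * bcoord R i s) * f s).
  by apply: linear_dictator => //; move: tot Wf Wg Wh; clear; lra.
have [j [b' [j_n gj]]] : exists i b, (i < n)%N /\ 11 / 12 <= EB n (fun s => (sgn R b * bcoord R i s) * g s).
  by apply: linear_dictator => //; move: tot Wf Wg Wh; clear; lra.
have [k [b'' [k_n hk]]] : exists i b, (i < n)%N /\ 11 / 12 <= EB n (fun s => (sgn R b * bcoord R i s) * h s).
  by apply: linear_dictator => //; move: tot Wf Wg Wh; clear; lra.
(* A mismatch leaves one correlation at least -1/6 and the other two at least -1/3 - 1/100, a sum
   too far from -1. *)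
have [[ij bb']|/eqP ne] := (i, b) =P (j, b'); last first.
  by have := C2_distinct i_n j_n pf pg fi gj ne; move: nt small Ggh Ghf; clear; lra.
have [[ik bb'']|/eqP ne] := (k, b'') =P (i, b); last first.
  by have := C2_distinct k_n i_n ph pf hk fi ne; move: nt small Gfg Ggh; clear; lra.
subst j b' k b''.
by exists i, b; split=> //; apply: near_dictator.
Qed.

End NearDictator.

                                                    

(** * Lower bounds for cycles by exponential moments *)

Section Tensor.
Variable R : realType.
Implicit Types f g h phi psi chi : seq bool -> R.

(** Both sides multiply over independent voters, so the induction reduces it to an inequality for a
    single voter. It acts as a reverse hypercontractive estimate: correlated events of substantial
    probability must meet. *)
Lemma tensor_lower n phi (a b : seq bool -> R) :
  EB n phi ^+ 2 * expR (EB n a + EB n b) <=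
  E3 n (fun x y z => phi x ^+ 2 * expR (a y + b z)).
Proof.
elim: n phi a b => [|n IH] phi a b; first by [].
rewrite E3S !EBS.
have I t u v := IH (fun s => phi (t :: s)) (fun s => a (u :: s)) (fun s => b (v :: s)).
have := I true true false; have := I true false true; have := I true false false.
have := I false true true; have := I false true false; have := I false false true.
move: (E3 _ _) (E3 _ _) (E3 _ _) (E3 _ _) (E3 _ _) (E3 _ _) => e6 e5 e4 e3 e2 e1.
set p := EB n (fun s => phi (true :: s)); set q := EB n (fun s => phi (false :: s)).
set A1 := EB n (fun s => a (true :: s)); set A0 := EB n (fun s => a (false :: s)).
set B1 := EB n (fun s => b (true :: s)); set B0 := EB n (fun s => b (false :: s)).
have sq (x : R) : expR x = expR (x / 2) ^+ 2 by rewrite expr2 -expRD; congr expR; field.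
rewrite (sq (A0 + B1)) (sq (A1 + B0)) (sq (A1 + B1)) (sq (A0 + B0)).
have -> : expR ((A1 + A0) / 2 + (B1 + B0) / 2) = expR ((A1 + B0) / 2) * expR ((A0 + B1) / 2).
  by rewrite -expRD; congr expR; field.
have : expR ((A1 + B0) / 2) * expR ((A0 + B1) / 2) = expR ((A1 + B1) / 2) * expR ((A0 + B0) / 2).
  by rewrite -!expRD; congr expR; field.
have := expR_gt0 ((A1 + B0) / 2); have := expR_gt0 ((A0 + B1) / 2).
set m := expR ((A1 + B0) / 2); set m' := expR ((A0 + B1) / 2).
set k := expR ((A1 + B1) / 2); set k' := expR ((A0 + B0) / 2).
move=> m'0 m0 mk e6h e5h e4h e3h e2h e1h.
(* The single-voter inequality follows from three nonnegative terms together with m m' = k k'. *)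
have P1 : 0 <= (p ^+ 2 + q ^+ 2) * (m - m') ^+ 2.
  by apply: mulr_ge0; [apply: addr_ge0|]; exact: sqr_ge0.
have P2 := sqr_ge0 (p * k' - q * k).
have P3 : 0 <= (m * m') * (p - q) ^+ 2.
  by apply: mulr_ge0; [apply: mulr_ge0; exact: ltW|exact: sqr_ge0].
have P4 : p * q * (m * m') = p * q * (k * k') by rewrite mk.
lra.
Qed.

Definition zo phi := forall s, phi s = 0 \/ phi s = 1.

(** Weight each failure of [psi] or [chi] by exp(-L) in [tensor_lower]: where both hold the
    exponential is 1, elsewhere at most exp(-L), which accounts for the subtracted term. *)
Lemma prob3_lower n phi psi chi (L : R) : zo phi -> zo psi -> zo chi -> 0 <= L ->
  EB n phi ^+ 2 * expR (- (L * (2 - EB n psi - EB n chi))) - expR (- L) * EB n phi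
  <= E3 n (fun x y z => phi x * psi y * chi z).
Proof.
move=> zf zp zc L0.
rewrite lerBlDr -(E3_x n phi) -E3Z -E3D E3_x.
have := tensor_lower n phi (fun s => - L * (1 - psi s)) (fun s => - L * (1 - chi s)).
rewrite !EBZ !EBB !EB_cst.
have -> : - L * (1 - EB n psi) + - L * (1 - EB n chi) = - (L * (2 - EB n psi - EB n chi)).
  by ring.
move/le_trans; apply; apply: le_E3 => x y z.
have L1 : 0 < expR (- L) <= 1 by rewrite expR_gt0 expR_le1 oppr_le0.
have L2 : expR (- L - L) <= expR (- L) by rewrite ler_expR; lra.
case: (zf x) => ->; case: (zp y) => ->; case: (zc z) => ->;
  rewrite ?subr0 ?subrr ?mulr1 ?mulr0 ?addr0 ?add0r ?expR0; lra.
Qed.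

Lemma xlnx_ge (x : R) : 0 < x -> -1 <= x * ln x.
Proof.
move=> x0; have := ln_sublinear (_ : 0 < x^-1); rewrite invr_gt0 => /(_ x0).
rewrite lnV ?posrE // => H; have := ler_wpM2l (ltW x0) (ltW H).
by rewrite mulfV ?gt_eqF //; lra.
Qed.

                                                                            
                                                                       
(** Take L = 20 - 2 ln(E phi) in [prob3_lower]: the subtracted term is then e^-20 (E phi)^3, and the
    main term at least e times as large. *)
Lemma prob3_cubic n phi psi chi (x : R) : zo phi -> zo psi -> zo chi ->
  0 < EB n phi -> EB n phi <= 1 ->
  0 <= x -> x <= 1 / 8 -> x <= EB n phi -> 2 - EB n psi - EB n chi <= 1 / 2 + 2 * x ->
  expR (- 20) * EB n phi ^+ 3 <= E3 n (fun x y z => phi x * psi y * chi z).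
Proof.
move=> zf zp zc; set o := EB n phi => o0 o1 x0 x8 xo gam.
have lo : ln o <= 0 by apply: ln_le0.
have xl : -1 <= x * ln o.
  have := xlnx_ge o0; have := ler_wnM2r lo xo; lra.
have L0 : 0 <= 20 - 2 * ln o by lra.
have := prob3_lower n zf zp zc L0; apply: le_trans.
have oE : o = expR (ln o) by rewrite lnK ?posrE.
have -> : expR (- (20 - 2 * ln o)) = expR (- 20) * o ^+ 2.
  rewrite {2}oE expr2 -!expRD; congr expR; ring.
(* The exponent is at least -10 - 40x + ln o + 4x ln o, where 40x <= 5 and x ln o >= -1. *)
have G : expR (- 19) * o <= expR (- ((20 - 2 * ln o) * (2 - EB n psi - EB n chi))).
  rewrite {1}oE -expRD ler_expR.
  have := ler_wpM2l L0 gam; have := mulr_ge0 x0 (_ : 0 <= - ln o).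
  lra.
have F : 2 * expR (- 20) <= expR (- 19 : R).
  have -> : - 19 = 1 + - 20 :> R by ring.
  rewrite expRD ler_wpM2r ?expR_ge0 //; have := expR_ge1Dx (1 : R); lra.
have := ler_wpM2l (sqr_ge0 o) G.
have := ler_wpM2l (exprn_ge0 3 (ltW o0)) F.
rewrite -/o; lra.
Qed.

Definition pos f (s : seq bool) := (1 + f s) / 2.
Definition neg f (s : seq bool) := (1 - f s) / 2.

Lemma zo_pos f : pm f -> zo (pos f).
Proof. by move=> pf s; rewrite /pos; case: (pf s) => ->; [right|left]; lra. Qed.

Lemma zo_neg f : pm f -> zo (neg f).
Proof. by move=> pf s; rewrite /neg; case: (pf s) => ->; [left|right]; lra. Qed.

Lemma EB_pos n f : EB n (pos f) = (1 + EB n f) / 2.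
Proof.
by rewrite -[X in X + _](EB_cst n) -EBD mulrC -EBZ; apply: eq_EB => s; rewrite mulrC.
Qed.

Lemma EB_neg n f : EB n (neg f) = (1 - EB n f) / 2.
Proof.
by rewrite -[X in X - _](EB_cst n) -EBB mulrC -EBZ; apply: eq_EB => s; rewrite mulrC.
Qed.

Definition P3 n phi psi chi := E3 n (fun x y z => phi x * psi y * chi z).

Lemma P3_rot n phi psi chi : P3 n phi psi chi = P3 n psi chi phi.
Proof.
by rewrite /P3 -[RHS]E3_rot; apply: eq_E3 => x y z; rewrite -mulrA mulrC.
Qed.

Lemma P3_ge0 n phi psi chi : zo phi -> zo psi -> zo chi -> 0 <= P3 n phi psi chi.
Proof.
move=> zf zp zc; apply: Ex_ge0 => s.
have ge0 k t : zo k -> 0 <= k t by move=> /(_ t) [] ->.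
by rewrite !mulr_ge0 ?ge0.
Qed.

Lemma NT_pos_neg n f g h :
  NT n f g h = P3 n (pos f) (pos g) (pos h) + P3 n (neg f) (neg g) (neg h).
Proof.
by rewrite /P3 -E3D; apply: eq_E3 => x y z; rewrite /pos /neg; field.
Qed.

Lemma NT_ge_pos n f g h : pm f -> pm g -> pm h ->
  P3 n (pos f) (pos g) (pos h) <= NT n f g h.
Proof.
by move=> pf pg ph; rewrite NT_pos_neg lerDl; apply: P3_ge0; exact: zo_neg.
Qed.

Lemma NT_ge_neg n f g h : pm f -> pm g -> pm h ->
  P3 n (neg f) (neg g) (neg h) <= NT n f g h.
Proof.
by move=> pf pg ph; rewrite NT_pos_neg lerDr; apply: P3_ge0; exact: zo_pos.
Qed.

Lemma NT_rot n f g h : NT n f g h = NT n g h f.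
Proof. by rewrite !NTE; lra. Qed.

Lemma NT_opp n f g h :
  NT n (fun s => - f s) (fun s => - g s) (fun s => - h s) = NT n f g h.
Proof. by apply: eq_E3 => x y z; rewrite !mulrNN. Qed.

Lemma P3_cubic n phi psi chi (x e : R) : zo phi -> zo psi -> zo chi ->
  0 < e -> e <= EB n phi -> EB n phi <= 1 ->
  0 <= x -> x <= 1 / 8 -> x <= EB n phi -> 2 - EB n psi - EB n chi <= 1 / 2 + 2 * x ->
  expR (- 20) * e ^+ 3 <= P3 n phi psi chi.
Proof.
move=> zf zp zc e0 ef f1 x0 x1 xf gam.
apply: le_trans (prob3_cubic zf zp zc (lt_le_trans e0 ef) f1 x0 x1 xf gam).
by rewrite ler_wpM2l ?expR_ge0 // lerXn2r ?nnegrE // ltW // (lt_le_trans e0).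
Qed.

(** [prob3_cubic] is tried with the rare event h = 1, g = 1 or f = -1, and x the smaller of its
    probability and 1/8. As f = -1 has probability at most 1/8, the three hypotheses on the
    remaining pairs cannot all fail. *)
Lemma NT_biased_pos n f g h (e : R) : pm f -> pm g -> pm h -> 0 < e ->
  2 * e - 1 <= EB n f <= 1 - 2 * e -> 2 * e - 1 <= EB n g <= 1 - 2 * e ->
  2 * e - 1 <= EB n h <= 1 - 2 * e -> 3 / 4 <= EB n f ->
  expR (- 20) * e ^+ 3 <= NT n f g h.
Proof.
move=> pf pg ph e0 /andP[f1 f2] /andP[g1 g2] /andP[h1 h2] f34.
have zpf := zo_pos pf; have zpg := zo_pos pg; have zph := zo_pos ph.
have znf := zo_neg pf; have zng := zo_neg pg; have znh := zo_neg ph.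
have N1 := NT_ge_pos n pf pg ph; have N2 := NT_ge_neg n pf pg ph.
pose m (t : R) := if t <= 1 / 8 then t else 1 / 8.
have mP t : 0 <= t -> [/\ 0 <= m t, m t <= 1 / 8 & m t <= t].
  by rewrite /m; case: (lerP t (1 / 8)) => *; split; lra.
have [A0 A1 A2] := mP ((1 + EB n h) / 2) ltac:(lra).
have [B0 B1 B2] := mP ((1 + EB n g) / 2) ltac:(lra).
have [C0 C1 C2] := mP ((1 - EB n f) / 2) ltac:(lra).
case: (lerP (2 - EB n (pos f) - EB n (pos g)) (1 / 2 + 2 * m ((1 + EB n h) / 2))) => Hh.
  apply: le_trans N1; rewrite 2!P3_rot; apply: P3_cubic Hh => //; rewrite ?EB_pos; lra.
case: (lerP (2 - EB n (pos h) - EB n (pos f)) (1 / 2 + 2 * m ((1 + EB n g) / 2))) => Hg.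
  apply: le_trans N1; rewrite P3_rot; apply: P3_cubic Hg => //; rewrite ?EB_pos; lra.
case: (lerP (2 - EB n (neg g) - EB n (neg h)) (1 / 2 + 2 * m ((1 - EB n f) / 2))) => Hf.
  apply: le_trans N2; apply: P3_cubic Hf => //; rewrite ?EB_neg; lra.
exfalso; move: Hh Hg Hf.
rewrite (EB_pos n f) (EB_pos n g) (EB_pos n h) (EB_neg n g) (EB_neg n h) /m.
move: (EB n f) (EB n g) (EB n h) f34 f1 f2 g1 g2 h1 h2 e0; clear => F G H.
by case: (lerP ((1 + H) / 2) (1 / 8)) => ?; case: (lerP ((1 + G) / 2) (1 / 8)) => ?;
  case: (lerP ((1 - F) / 2) (1 / 8)) => ?; lra.
Qed.

Lemma NT_biased n f g h (e : R) : pm f -> pm g -> pm h -> 0 < e ->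
  2 * e - 1 <= EB n f <= 1 - 2 * e -> 2 * e - 1 <= EB n g <= 1 - 2 * e ->
  2 * e - 1 <= EB n h <= 1 - 2 * e -> ~~ (- 3 / 4 < EB n f < 3 / 4) ->
  expR (- 20) * e ^+ 3 <= NT n f g h.
Proof.
move=> pf pg ph e0 bf bg bh; rewrite negb_and -!leNgt => /orP[] Hf; last first.
  exact: NT_biased_pos.
have bN k : 2 * e - 1 <= EB n k <= 1 - 2 * e -> 2 * e - 1 <= EB n (fun s => - k s) <= 1 - 2 * e.
  by move=> /andP[? ?]; rewrite EBN; apply/andP; split; lra.
rewrite -NT_opp; apply: NT_biased_pos => //; try exact: bN; try exact: pm_opp.
by rewrite EBN; lra.
Qed.

(** The failure probabilities of g = 1 and h = 1 sum to at most 1 - 1/1000, so L >= 15000 gains a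
    factor e^15 >= 16 over exp(-L). With p the probability of f = 1, 16 p^2 - p >= 1/8 for p >=
    1/8. *)
Lemma NT_unbalanced n f g h (L : R) : pm f -> pm g -> pm h -> 0 <= L ->
  15 * 1000 <= L -> - 3 / 4 <= EB n f -> 2 / 1000 <= EB n g + EB n h ->
  expR (- L) / 8 <= NT n f g h.
Proof.
move=> pf pg ph L0 L1 f1 gh.
apply: le_trans (NT_ge_pos n pf pg ph).
have := prob3_lower n (zo_pos pf) (zo_pos pg) (zo_pos ph) L0; apply: le_trans.
rewrite !EB_pos; set F := (1 + EB n f) / 2.
have f8 : 1 / 8 <= F by rewrite /F; lra.
have : 16 * expR (- L) <= expR (- (L * (2 - (1 + EB n g) / 2 - (1 + EB n h) / 2))).
  apply: (@le_trans _ _ (expR (15 - L))).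
    by rewrite expRD ler_wpM2r ?expR_ge0 //; have := expR_ge1Dx (15 : R); lra.
  rewrite ler_expR; have := ler_wpM2l L0 gh; lra.
have := expR_gt0 (- L); set v := expR (- L); set u := expR (- (L * _)) => v0 uv.
have := ler_wpM2l (sqr_ge0 F) uv.
have : 0 <= (F - 1 / 8) * F * v.
  by apply: mulr_ge0; [apply: mulr_ge0; lra|exact: ltW].
have : 0 <= (F - 1 / 8) * v by apply: mulr_ge0; [lra|exact: ltW].
lra.
Qed.

(** [NT_unbalanced], applied to f, g, h, their rotations and negatives, puts every sum of two means
    within 2/1000 of 0, hence every mean within 3/1000. *)
Lemma NT_central n f g h : pm f -> pm g -> pm h ->
  - 3 / 4 <= EB n f <= 3 / 4 -> - 3 / 4 <= EB n g <= 3 / 4 ->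
  - 3 / 4 <= EB n h <= 3 / 4 -> NT n f g h < expR (- (15 * 1000)) / 8 ->
  exists i b, (i < n)%N /\ dist3 n i b f g h <= 18 * NT n f g h.
Proof.
move=> pf pg ph /andP[f1 f2] /andP[g1 g2] /andP[h1 h2] small.
have U f' g' h' : pm f' -> pm g' -> pm h' -> - 3 / 4 <= EB n f' ->
    NT n f' g' h' = NT n f g h -> EB n g' + EB n h' <= 2 / 1000.
  move=> pf' pg' ph' f'1 E; rewrite leNgt; apply/negP => /ltW gh'.
  have := NT_unbalanced pf' pg' ph' (_ : 0 <= 15 * 1000) (lexx _) f'1 gh'.
  by rewrite E; lra.
have U1 := U f g h pf pg ph f1 (erefl _).
have U2 := U g h f pg ph pf g1 (esym (NT_rot _ _ _ _)).
have U3 := U h f g ph pf pg h1 (NT_rot _ _ _ _).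
have N (k : seq bool -> R) : EB n k <= 3 / 4 -> - 3 / 4 <= EB n (fun s => - k s).
  by rewrite EBN; clear; lra.
have V1 := U _ _ _ (pm_opp pf) (pm_opp pg) (pm_opp ph) (N _ f2) (NT_opp _ _ _ _).
have V2 := U _ _ _ (pm_opp pg) (pm_opp ph) (pm_opp pf) (N _ g2)
  (etrans (NT_opp _ _ _ _) (esym (NT_rot _ _ _ _))).
have V3 := U _ _ _ (pm_opp ph) (pm_opp pf) (pm_opp pg) (N _ h2)
  (etrans (NT_opp _ _ _ _) (NT_rot _ _ _ _)).
rewrite !EBN in V1 V2 V3.
have S : expR (- (15 * 1000)) <= 1 / 1000 / 1000 :> R.
  apply: (@le_trans _ _ (expR (- 1000 - 1000))); first by rewrite ler_expR; lra.
  have H : expR (- 1000 : R) <= 1000^-1.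
    rewrite expRN lef_pV2 ?posrE ?expR_gt0 //.
    by have := expR_ge1Dx (1000 : R); lra.
  by rewrite expRD div1r; apply: ler_pM => //; exact: expR_ge0.
apply: balanced_dictator => //; try (apply/andP; split);
  move: U1 U2 U3 V1 V2 V3 small S; clear; lra.
Qed.

End Tensor.

                                             

(** * A robust Harris inequality on chains of length three *)

Section Harris.
Variable R : realFieldType.
Implicit Types f g : seq nat -> R.

Definition T3 : seq nat := [:: 0; 1; 2]%N.
Definition E3v n f : R := Ex T3 n f.

Definition pp (x : R) : R := Num.max x 0.

Lemma pp_ge0 x : 0 <= pp x.
Proof. by rewrite le_max lexx orbT. Qed.

Lemma pp_ge x : x <= pp x.
Proof. by rewrite le_max lexx. Qed.

Lemma pp_E3v n f : pp (E3v n f) <= E3v n (fun s => pp (f s)).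
Proof.
rewrite ge_max; apply/andP; split; first by apply: le_Ex => s; exact: pp_ge.
by apply: Ex_ge0 => s; exact: pp_ge0.
Qed.

Definition jumps (F : nat -> R) : R :=
  pp (F 1%N - F 0%N) + pp (F 2%N - F 0%N) + pp (F 2%N - F 1%N).

(** Average upward movement, summed over the coordinates; it vanishes when f is nonincreasing in
    each coordinate. *)
Fixpoint bd n f : R :=
  if n is m.+1 then
    (\sum_(t <- T3) bd m (fun s => f (t :: s))) / 3 +
    E3v m (fun s => jumps (fun t => f (t :: s)) / 9)
  else 0.

Lemma E3vS n f : E3v n.+1 f =
  (E3v n (fun s => f (0%N :: s)) + E3v n (fun s => f (1%N :: s)) +
   E3v n (fun s => f (2%N :: s))) / 3.
Proof. by rewrite /E3v ExS !big_cons big_nil addr0 addrA. Qed.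

Lemma jumps_E3v n f :
  jumps (fun t => E3v n (fun s => f (t :: s))) <=
  E3v n (fun s => jumps (fun t => f (t :: s))).
Proof.
rewrite /jumps /E3v !ExD; apply: lerD; [apply: lerD|]; rewrite -ExB; exact: pp_E3v.
Qed.

Lemma pair_harris (a b c d : R) : 0 <= a <= 1 -> 0 <= b <= 1 -> 0 <= c <= 1 -> 0 <= d <= 1 ->
  - ((b - a) * (d - c)) <= pp (b - a) + pp (d - c).
Proof.
move=> /andP[a0 a1] /andP[b0 b1] /andP[c0 c1] /andP[d0 d1].
have := pp_ge (b - a); have := pp_ge (d - c).
have := pp_ge0 (b - a); have := pp_ge0 (d - c).
move: (pp _) (pp _) => u v u0 v0 u1 v1.
case: (lerP a b) => ab; case: (lerP c d) => cd.
- have := mulr_ge0 (_ : 0 <= b - a) (_ : 0 <= d - c); lra.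
- have := mulr_ge0 (_ : 0 <= b - a) (_ : 0 <= 1 - c + d); lra.
- have := mulr_ge0 (_ : 0 <= 1 - a + b) (_ : 0 <= d - c); lra.
- have := mulr_ge0 (_ : 0 <= a - b) (_ : 0 <= c - d); lra.
Qed.

                                                                            
                                                 
(** Chebyshev's identity on three points: E f E g - E fg is -1/9 times the sum over j < k of the
    products of increments. A product is negative only if one factor goes up, which [pair_harris]
    charges to [bd]. *)
Lemma harris n f g : (forall s, 0 <= f s <= 1) -> (forall s, 0 <= g s <= 1) ->
  E3v n f * E3v n g <= E3v n (fun s => f s * g s) + bd n f + bd n g.
Proof.
elim: n f g => [|n IH] f g f01 g01; first by rewrite /E3v /= !addr0.
rewrite !E3vS /=.
have E01 k t : (forall s, 0 <= k s <= 1) -> 0 <= E3v n (fun s => k (t :: s)) <= 1.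
  move=> k01; apply/andP; split; first by apply: Ex_ge0 => s; case/andP: (k01 (t :: s)).
  by apply: Ex_le1 => // s; case/andP: (k01 (t :: s)).
have I t := IH (fun s => f (t :: s)) (fun s => g (t :: s)) (fun s => f01 _) (fun s => g01 _).
rewrite !big_cons !big_nil !addr0.
rewrite -!/(Ex T3 n _) /E3v.
have Jf := jumps_E3v n f; have Jg := jumps_E3v n g.
have JE k : E3v n (fun s => jumps (fun t => k (t :: s)) / 9) =
    E3v n (fun s => jumps (fun t => k (t :: s))) / 9.
  by rewrite mulrC /E3v -ExZ; apply: eq_Ex => s; rewrite mulrC.
rewrite -!/(E3v n _) !JE.
have := I 0%N; have := I 1%N; have := I 2%N.
have Pf t := E01 f t f01; have Pg t := E01 g t g01.
have := pair_harris (Pf 0%N) (Pf 1%N) (Pg 0%N) (Pg 1%N).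
have := pair_harris (Pf 0%N) (Pf 2%N) (Pg 0%N) (Pg 2%N).
have := pair_harris (Pf 1%N) (Pf 2%N) (Pg 1%N) (Pg 2%N).
move: Jf Jg; rewrite {1 3}/jumps; clear; lra.
Qed.

End Harris.

(** * From upward jumps to manipulations, for one pair of alternatives *)

Definition pref (c : code) (a b : nat) : bool :=
  match a, b with
  | 0, 1 => c0 c | 1, 0 => ~~ c0 c
  | 1, 2 => c1 c | 2, 1 => ~~ c1 c
  | 2, 0 => c2 c | 0, 2 => ~~ c2 c
  | _, _ => false
  end.

Definition cd0 : code := (true, true, false).

Section Manipulation.
Variable R : realFieldType.
Implicit Type F : seq code -> 'I_3.

Definition Msum n F : R := \sum_(i < n) Ex L6 n (fun s =>
  (\sum_(t <- L6) (pref (nth cd0 s i) (F (set_nth cd0 s i t)) (F s))%:R) / 6).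

Lemma MsumS n F : Msum n.+1 F =
  (\sum_(t <- L6) Msum n (fun s => F (t :: s))) / 6 +
  Ex L6 n (fun s => (\sum_(t <- L6) \sum_(u <- L6)
     (pref t (F (u :: s)) (F (t :: s)))%:R) / 36).
Proof.
rewrite /Msum big_ord_recl addrC; congr (_ + _).
  by rewrite exchange_big mulr_suml; apply: eq_bigr => i _.
rewrite ExS /= -Ex_sum mulrC -ExZ; apply: eq_Ex => s.
rewrite mulr_sumr mulr_suml; apply: eq_bigr => t _.
by rewrite -[36%:R]/((6 * 6)%:R) natrM; field.
Qed.

Section Pair.
Variables (a b : nat) (bit : code -> bool) (comb : bool -> nat -> code).

                                                                              
                                                                              
                                                                     
                                                
(** From [comb v j] to [comb v k] the third alternative rises while a and b keep their order. When
    the outcome changes from w to e in {a, b}, either the voter at k gains by reporting j or the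
    voter at j by reporting k: if w is the third alternative and beats e at j, it still does at k;
    if w is the other member, their order is the same at both. *)
Definition sep (e : nat) := forall v j k (w : 'I_3), (j < k < 3)%N -> nat_of_ord w <> e ->
  pref (comb v k) w e || pref (comb v j) e w.

Hypothesis (comb_perm : perm_eq [seq comb v j | v <- B2, j <- T3] L6).
Hypothesis (comb_bit : forall v j, j \in T3 -> bit (comb v j) = v).
Hypothesis (sep_a : sep a).
Hypothesis (sep_b : sep b).
Hypothesis (ab : a <> b).

Definition zc (z : seq bool) (v : seq nat) : seq code := [seq comb p.1 p.2 | p <- zip z v].

Lemma Ex_comb n (G : seq code -> R) :
  Ex L6 n G = EB n (fun z => E3v n (fun v => G (zc z v))).
Proof. by rewrite -(Ex_perm _ _ comb_perm) Ex_zip. Qed.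

Lemma zc_bit n (z : seq bool) v : size z = n -> size v = n -> all (mem T3) v ->
  map bit (zc z v) = z.
Proof.
elim: n z v => [|n IH] [|x z] [|j v] //= [sz] [sv] /andP[jT vT].
by rewrite comb_bit // /zc /= -/(zc z v) IH.
Qed.

Definition ind F (e : nat) z v : R := (nat_of_ord (F (zc z v)) == e)%:R.

Lemma jump_manip (Y : code -> 'I_3) v j k : (j < k < 3)%N ->
  pp ((nat_of_ord (Y (comb v k)) == a)%:R - (nat_of_ord (Y (comb v j)) == a)%:R) +
  pp ((nat_of_ord (Y (comb v k)) == b)%:R - (nat_of_ord (Y (comb v j)) == b)%:R) <=
  (pref (comb v k) (Y (comb v j)) (Y (comb v k)))%:R +
  (pref (comb v j) (Y (comb v k)) (Y (comb v j)))%:R :> R.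
Proof.
move=> jk.
have p0 : pp (0 : R) = 0 by rewrite /pp maxxx.
have p1 : pp (1 : R) = 1 by rewrite /pp; apply/max_idPl; exact: ler01.
have pN : pp (-1 : R) = 0 by rewrite /pp; apply/max_idPr; lra.
have nn (x y : bool) : 0 <= x%:R + y%:R :> R by rewrite addr_ge0.
have nn1 (x y : bool) : x || y -> 1 <= x%:R + y%:R :> R by case: x y => [] [] //= _; lra.
case: (nat_of_ord (Y (comb v k)) =P a) => [ka|ka].
  have kb : (nat_of_ord (Y (comb v k)) == b) = false by apply/eqP; rewrite ka.
  rewrite kb; case: (nat_of_ord (Y (comb v j)) =P a) => ja.
    have -> : (nat_of_ord (Y (comb v j)) == b) = false by apply/eqP; rewrite ja.
    by rewrite !subrr p0 addr0.
  have := sep_a v jk ja; rewrite ka => /nn1; apply: le_trans.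
  by rewrite subr0 p1 sub0r; case: (_ == b); rewrite ?oppr0 ?pN ?p0 addr0.
have H1 : pp (0%:R - (nat_of_ord (Y (comb v j)) == a)%:R) = 0 :> R.
  by rewrite sub0r; case: (_ == a); rewrite ?oppr0 ?pN ?p0.
rewrite H1 add0r.
case: (nat_of_ord (Y (comb v k)) =P b) => [kb|kb]; last first.
  by rewrite sub0r; case: (_ == b); rewrite ?oppr0 ?pN ?p0.
case: (nat_of_ord (Y (comb v j)) =P b) => jb; first by rewrite subrr p0.
by have := sep_b v jk jb; rewrite kb subr0 p1 => /nn1.
Qed.

Lemma jumps_manip (Y : code -> 'I_3) :
  \sum_(v <- B2) (jumps (fun t => (nat_of_ord (Y (comb v t)) == a)%:R) +
     jumps (fun t => (nat_of_ord (Y (comb v t)) == b)%:R)) <=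
  \sum_(t <- L6) \sum_(u <- L6) (pref t (Y u) (Y t))%:R :> R.
Proof.
rewrite -(perm_big _ comb_perm) big_allpairs_dep /=.
apply: ler_sum => v _.
apply: (@le_trans _ _ (\sum_(j <- T3) \sum_(k <- T3)
   (pref (comb v j) (Y (comb v k)) (Y (comb v j)))%:R)); last first.
  apply: ler_sum => j _; rewrite -(perm_big _ comb_perm) big_allpairs_dep /=.
  rewrite /B2 [leRHS]big_cons big_seq1.
  by case: v; rewrite ?lerDl ?lerDr sumr_ge0.
have := @jump_manip Y v 0 1 isT; have := @jump_manip Y v 0 2 isT.
have := @jump_manip Y v 1 2 isT.
rewrite /jumps !big_cons !big_nil.
have nn (x : bool) : 0 <= x%:R :> R by [].
have := nn (pref (comb v 0%N) (Y (comb v 0%N)) (Y (comb v 0%N))).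
have := nn (pref (comb v 1%N) (Y (comb v 1%N)) (Y (comb v 1%N))).
have := nn (pref (comb v 2%N) (Y (comb v 2%N)) (Y (comb v 2%N))).
lra.
Qed.

(** Each upward jump of either indicator is a manipulation ([jump_manip]). The weights are 1/18 per
    pair of orders sharing the bit against 1/36 in [Msum], hence the factor 2. *)
Lemma bd_manip n F :
  EB n (fun z => bd n (ind F a z) + bd n (ind F b z)) <= 2 * Msum n F.
Proof.
elim: n F => [|n IH] F.
  by rewrite /Msum big_ord0 /EB /= addr0 mulr0.
rewrite MsumS EBS /=.
pose X v t z := bd n (ind (fun s => F (comb v t :: s)) a z) + bd n (ind (fun s => F (comb v t :: s)) b z).
pose J v z := E3v n (fun w => (jumps (fun t => (nat_of_ord (F (comb v t :: zc z w)) == a)%:R) +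
   jumps (fun t => (nat_of_ord (F (comb v t :: zc z w)) == b)%:R)) / 9) : R.
have E v : EB n (fun z => bd n.+1 (ind F a (v :: z)) + bd n.+1 (ind F b (v :: z))) =
    (\sum_(t <- T3) EB n (X v t)) / 3 + EB n (J v).
  rewrite /EB -Ex_sum mulrC -ExZ -ExD; apply: eq_Ex => z /=.
  have -> : J v z =
    E3v n (fun w => jumps (fun t => (nat_of_ord (F (comb v t :: zc z w)) == a)%:R) / 9) +
    E3v n (fun w => jumps (fun t => (nat_of_ord (F (comb v t :: zc z w)) == b)%:R) / 9).
    by rewrite /J /E3v -ExD; apply: eq_Ex => w; rewrite mulrDl.
  by rewrite /X big_split /ind /zc /=; ring.
have JM : EB n (fun z => (J true z + J false z) / 2) <=
  2 * Ex L6 n (fun s => (\sum_(t <- L6) \sum_(u <- L6) (pref t (F (u :: s)) (F (t :: s)))%:R) / 36).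
  rewrite -ExZ Ex_comb; apply: le_EB => z.
  rewrite /J /E3v -ExD mulrC -ExZ; apply: le_Ex => w.
  have := jumps_manip (fun t => F (t :: zc z w)); rewrite !big_cons big_nil.
  lra.
have XM : (\sum_(v <- B2) \sum_(t <- T3) EB n (X v t)) / 6 <=
   2 * ((\sum_(t <- L6) Msum n (fun s => F (t :: s))) / 6).
  rewrite -(perm_big _ comb_perm) big_allpairs_dep /= mulrA ler_wpM2r ?invr_ge0 //.
  rewrite mulr_sumr; apply: ler_sum => v _; rewrite mulr_sumr; apply: ler_sum => t _.
  exact: IH.
rewrite [leLHS](_ : _ = (\sum_(v <- B2) \sum_(t <- T3) EB n (X v t)) / 6 +
   EB n (fun z => (J true z + J false z) / 2)); first by rewrite mulrDr lerD.
have -> : EB n (fun z => (J true z + J false z) / 2) = (EB n (J true) + EB n (J false)) / 2.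
  by rewrite -EBD mulrC -EBZ; apply: eq_EB => z; rewrite mulrC.
by rewrite (E true) (E false) !big_cons !big_nil; field.
Qed.

Lemma Ex_ind n F (k : seq bool -> R) (e : nat) :
  Ex L6 n (fun s => (nat_of_ord (F s) == e)%:R * k (map bit s)) =
  EB n (fun z => E3v n (ind F e z) * k z).
Proof.
rewrite Ex_comb; apply: eq_Ex_in => z sz _; rewrite mulrC -ExZ.
by apply: eq_Ex_in => v sv vT; rewrite (zc_bit sz) // mulrC.
Qed.

(** With f following the likelier outcome given z, the error given z is the smaller of the two
    conditional probabilities. Its squared mean is at most the mean of their product, which [harris]
    bounds by upward jumps. *)
Lemma pair_social n F : exists2 f : seq bool -> R, pm f &
  Ex L6 n (fun s => (nat_of_ord (F s) == a)%:R * ((1 - f (map bit s)) / 2) +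
                    (nat_of_ord (F s) == b)%:R * ((1 + f (map bit s)) / 2)) ^+ 2
  <= 2 * Msum n F.
Proof.
pose Pa z : R := E3v n (ind F a z); pose Pb z : R := E3v n (ind F b z).
pose f z : R := if Pb z < Pa z then 1 else -1.
exists f; first by move=> z; rewrite /f; case: ifP; [left|right].
have H01 e z v : 0 <= (ind F e z v : R) <= 1 by rewrite /ind; case: eqP; rewrite ?lexx ler01.
have P0 e z : 0 <= (E3v n (ind F e z) : R) by apply: Ex_ge0 => v; case/andP: (H01 e z v).
rewrite ExD (Ex_ind n F (fun z => (1 - f z) / 2)) (Ex_ind n F (fun z => (1 + f z) / 2)) -EBD.
rewrite (@eq_EB _ _ _ (fun z => Num.min (Pa z) (Pb z))); last first.
  move=> z; rewrite -/(Pa z) -/(Pb z) minElt /f.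
  case: (ltgtP (Pb z) (Pa z)) => H; lra.
apply: (@le_trans _ _ (EB n (fun z => Num.min (Pa z) (Pb z) ^+ 2))).
  by have := Var_ge0 n (fun z => Num.min (Pa z) (Pb z)); rewrite /Var subr_ge0.
apply: le_trans (bd_manip n F); apply: le_EB => z.
apply: (@le_trans _ _ (Pa z * Pb z)).
  have a0 := P0 a z; have b0 := P0 b z.
  by rewrite expr2; apply: ler_pM; rewrite ?le_min ?a0 ?b0 // ge_min lexx ?orbT.
apply: le_trans (harris n (H01 a z) (H01 b z)) _.
(* The outcomes a and b exclude each other, so the product of their indicators is 0. *)
rewrite -addrA gerDr -[leRHS](@Ex_cst R _ T3 n) //; apply: le_Ex => v.
rewrite /ind; case: eqP => [->|_]; last by rewrite mul0r.
by case: eqP => // _; rewrite mulr0.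
Qed.

End Pair.
End Manipulation.

(** * Social preferences on all three pairs *)

(** [v] fixes the order of 0 and 1; [j] = 0, 1, 2 puts alternative 2 at the bottom, middle, top.
    [comb12] and [comb20] are its cyclic rotations. *)
Definition comb01 (v : bool) (j : nat) : code :=
  match v, j with
  | true, 0 => (true, true, false)
  | true, 1 => (true, false, false)
  | true, _ => (true, false, true)
  | false, 0 => (false, true, false)
  | false, 1 => (false, true, true)
  | false, _ => (false, false, true)
  end.

Definition comb12 v j : code := let c := comb01 v j in (c2 c, c0 c, c1 c).
Definition comb20 v j : code := let c := comb01 v j in (c1 c, c2 c, c0 c).

Definition topc (c : code) : nat :=
  if c0 c && ~~ c2 c then 0%N else if c1 c && ~~ c0 c then 1%N else 2.
Definition botc (c : code) : nat :=
  if ~~ c0 c && c2 c then 0%N else if ~~ c1 c && c0 c then 1%N else 2.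

Section Social.
Variable R : realFieldType.
Implicit Type F : seq code -> 'I_3.

(** Indicator that the outcome is the member of the pair which f rejects; f = 1 reads as a over
    b. *)
Definition err (a b : nat) (bit : code -> bool) F (f : seq bool -> R) s : R :=
  (nat_of_ord (F s) == a)%:R * ((1 - f (map bit s)) / 2) +
  (nat_of_ord (F s) == b)%:R * ((1 + f (map bit s)) / 2).

Lemma social01 n F : exists2 f : seq bool -> R, pm f &
  Ex L6 n (err 0 1 c0 F f) ^+ 2 <= 2 * Msum R n F.
Proof.
apply: (@pair_social _ _ _ c0 comb01) => //; first by move=> [] [|[|[|j]]].
- by move=> [] [|[|[|j]]] [|[|[|k]]] [[|[|[|w]]] wl].
- by move=> [] [|[|[|j]]] [|[|[|k]]] [[|[|[|w]]] wl].
Qed.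

Lemma social12 n F : exists2 f : seq bool -> R, pm f &
  Ex L6 n (err 1 2 c1 F f) ^+ 2 <= 2 * Msum R n F.
Proof.
apply: (@pair_social _ _ _ c1 comb12) => //; first by move=> [] [|[|[|j]]].
- by move=> [] [|[|[|j]]] [|[|[|k]]] [[|[|[|w]]] wl].
- by move=> [] [|[|[|j]]] [|[|[|k]]] [[|[|[|w]]] wl].
Qed.

Lemma social20 n F : exists2 f : seq bool -> R, pm f &
  Ex L6 n (err 2 0 c2 F f) ^+ 2 <= 2 * Msum R n F.
Proof.
apply: (@pair_social _ _ _ c2 comb20) => //; first by move=> [] [|[|[|j]]].
- by move=> [] [|[|[|j]]] [|[|[|k]]] [[|[|[|w]]] wl].
- by move=> [] [|[|[|j]]] [|[|[|k]]] [[|[|[|w]]] wl].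
Qed.

Definition err3 F (f g h : seq bool -> R) s : R :=
  err 0 1 c0 F f s + err 1 2 c1 F g s + err 2 0 c2 F h s.

Lemma I3P (w : 'I_3) : [\/ nat_of_ord w = 0%N, nat_of_ord w = 1%N | nat_of_ord w = 2%N].
Proof. by case: w => [[|[|[|w]]]] //=; [constructor 1|constructor 2|constructor 3]. Qed.

Lemma err_ge0 a b bit F f s : pm f -> 0 <= err a b bit F f s.
Proof.
by move=> pf; rewrite /err; case: (pf (map bit s)) => ->; do 2 case: eqP => _ /=; lra.
Qed.

(** In a cycle every alternative loses to another one, so any outcome is an error for some pair. *)
Lemma NT_le_err3 n F f g h : pm f -> pm g -> pm h ->
  NT n f g h <= Ex L6 n (err3 F f g h).
Proof.
move=> pf pg ph; apply: le_Ex => s; rewrite /err3 /err.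
case: (I3P (F s)) => -> /=; case: (pf (map c0 s)) => ->;
  case: (pg (map c1 s)) => ->; case: (ph (map c2 s)) => ->; lra.
Qed.

Definition Palt n F (k : nat) : R := Ex L6 n (fun s => (nat_of_ord (F s) == k)%:R).

Lemma Palt_le_pos n a b bit F f : pm f ->
  (forall G : seq bool -> R, Ex L6 n (fun s => G (map bit s)) = EB n G) ->
  Palt n F a - Ex L6 n (err a b bit F f) <= (1 + EB n f) / 2.
Proof.
move=> pf bitE; rewrite -ExB.
have -> : (1 + EB n f) / 2 = Ex L6 n (fun s => (1 + f (map bit s)) / 2).
  rewrite (bitE (fun z => (1 + f z) / 2)) mulrC -[X in X + _](EB_cst n) -EBD -EBZ.
  by apply: eq_EB => z; rewrite mulrC.
apply: le_Ex => s; rewrite /err.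
by case: (pf (map bit s)) => ->; do 2 case: eqP => _ /=; lra.
Qed.

Lemma Palt_le_neg n a b bit F f : pm f ->
  (forall G : seq bool -> R, Ex L6 n (fun s => G (map bit s)) = EB n G) ->
  Palt n F b - Ex L6 n (err a b bit F f) <= (1 - EB n f) / 2.
Proof.
move=> pf bitE; rewrite -ExB.
have -> : (1 - EB n f) / 2 = Ex L6 n (fun s => (1 - f (map bit s)) / 2).
  rewrite (bitE (fun z => (1 - f z) / 2)) mulrC -[X in X - _](EB_cst n) -EBB -EBZ.
  by apply: eq_EB => z; rewrite mulrC.
apply: le_Ex => s; rewrite /err.
by case: (pf (map bit s)) => ->; do 2 case: eqP => _ /=; lra.
Qed.

Definition wrong (w : code -> nat) F i s : R := (nat_of_ord (F s) != w (nth cd0 s i))%:R.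

Lemma L6_ind (P : code -> Prop) :
  P (true, true, false) -> P (true, false, true) -> P (true, false, false) ->
  P (false, true, true) -> P (false, true, false) -> P (false, false, true) ->
  forall c, c \in L6 -> P c.
Proof. by move=> ? ? ? ? ? ? [[[] []] []]. Qed.

(** If f, g, h all follow the signed bits of voter i, the social order is that voter's order or its
    reverse, and every outcome but its top is rejected by one of them. *)
Lemma wrong_le n i b F f g h : pm f -> pm g -> pm h -> (i < n)%N ->
  Ex L6 n (wrong (if b then topc else botc) F i) <=
  Ex L6 n (err3 F f g h) + dist3 n i b f g h.
Proof.
move=> pf pg ph i_n.
have E (k : seq bool -> R) : (1 - EB n (fun s => sgn R b * bcoord R i s * k s)) / 2 =
    EB n (fun s => (1 - sgn R b * bcoord R i s * k s) / 2).
  rewrite mulrC -[X in X - _](EB_cst n) -EBB -EBZ.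
  by apply: eq_EB => z; rewrite mulrC.
rewrite /dist3 !E -E3_x -[X in _ + X + _]E3_y -[X in _ + _ + X]E3_z -!ExD.
apply: le_Ex_in => s sn sL.
have i_s : (i < size s)%N by rewrite sn.
have cL : nth cd0 s i \in L6 by apply: (allP sL); exact: mem_nth.
rewrite /wrong /err3 /err /bcoord !(nth_map cd0) //.
have pmE k z : pm k -> exists u, k z = sgn R u.
  by move=> pk; case: (pk z) => ->; [exists true|exists false].
have [u ->] := pmE f (map c0 s) pf; have [v ->] := pmE g (map c1 s) pg.
have [w ->] := pmE h (map c2 s) ph.
have negE x : (1 - sgn R x) / 2 = (~~ x)%:R by case: x; rewrite /sgn /=; field.
have posE x : (1 + sgn R x) / 2 = x%:R by case: x; rewrite /sgn /=; field.
have mulE x y z : sgn R x * sgn R y * sgn R z = sgn R (x (+) y (+) z).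
  by case: x y z => [] [] []; rewrite /sgn /=; ring.
rewrite !mulE !negE !posE -!natrM -!natrD ler_nat.
move: (nth cd0 s i) cL; apply: L6_ind; case: (I3P (F s)) => ->;
  by case: b u v w {E} => [] [] [] [].
Qed.

(** Redraw the vote of i: with probability 2/3 the bottom changes. If F outputs the reported bottom
    both before and after, the new report replaces the true bottom by something better. Each of the
    two outputs fails with the probability of [wrong], by [Ex_resample]. *)
Lemma bottom_manip n i F : (i < n)%N ->
  2 / 3 - 2 * Ex L6 n (wrong botc F i) <= Msum R n F.
Proof.
move=> i_n.
apply: (@le_trans _ _ (Ex L6 n (fun s =>
  (\sum_(t <- L6) (pref (nth cd0 s i) (F (set_nth cd0 s i t)) (F s))%:R) / 6))); last first.
  rewrite /Msum (bigD1 (Ordinal i_n)) //= lerDl sumr_ge0 // => j _.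
  by apply: Ex_ge0 => s; rewrite mulr_ge0 ?invr_ge0 // sumr_ge0.
have two (x : R) : 2 / 3 - 2 * x = 2 / 3 - x - x by ring.
rewrite two -{2}(@Ex_resample _ _ cd0 L6 i n) //.
rewrite -[X in X - _ - _](@Ex_cst _ _ L6 n) // -!ExB.
apply: le_Ex_in => s sn sL.
have i_s : (i < size s)%N by rewrite sn.
have cL : nth cd0 s i \in L6 by apply: (allP sL); exact: mem_nth.
have cE : 2 / 3 = (\sum_(t <- L6) (botc t != botc (nth cd0 s i))%:R) / 6 :> R.
  by elim/L6_ind: (nth cd0 s i) / cL; rewrite !big_cons big_nil /=; lra.
have wE : wrong botc F i s = (\sum_(t <- L6) wrong botc F i s) / 6.
  by rewrite !big_cons big_nil; field.
rewrite cE wE -!mulrBl ler_wpM2r ?invr_ge0 // -!sumrB big_seq [leRHS]big_seq.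
apply: ler_sum => t tL; rewrite /wrong nth_set_nth /= eqxx.
move: (F (set_nth _ _ _ _)) (F s) => w w'.
move: (nth cd0 s i) cL {cE} => c cL.
rewrite !lerBlDr -!natrD ler_nat.
by elim/L6_ind: c / cL; elim/L6_ind: t / tL; case: (I3P w) => ->; case: (I3P w') => ->.
Qed.

End Social.

(** * Combining the cases *)

Section Core.
Variable R : realType.
Implicit Type F : seq code -> 'I_3.

(** The bound of [NT_unbalanced] at L = 15000. The 1/8 in [kbias] comes from using [NT_biased] at e
    / 2. *)
Definition kbal : R := expR (- (15 * 1000)) / 8.
Definition kbias : R := expR (- 20) / 8.

Lemma kbal_gt0 : 0 < kbal.
Proof. by rewrite divr_gt0 ?expR_gt0. Qed.

Lemma kbal_le1 : kbal <= 1.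
Proof.
have : expR (- (15 * 1000)) <= 1 :> R by rewrite expR_le1; lra.
by rewrite /kbal; lra.
Qed.

Lemma kbias_gt0 : 0 < kbias.
Proof. by rewrite divr_gt0 ?expR_gt0. Qed.

Lemma kbias_le1 : kbias <= 1.
Proof.
have : expR (- 20) <= 1 :> R by rewrite expR_le1; lra.
by rewrite /kbias; lra.
Qed.

(** Either N or [NT] is large, or [NT_central] applies. A dictator gives e <= N + 18 [NT] <= 19 N; a
    reversed one with N < 1/100 leaves a constant in [bottom_manip]. *)
Lemma central_manip n F f g h (e N : R) : pm f -> pm g -> pm h ->
  N = Ex L6 n (err3 F f g h) -> 0 <= N -> N ^+ 2 <= 18 * Msum R n F ->
  0 < e -> e <= 1 -> (forall i, (i < n)%N -> e <= Ex L6 n (wrong R topc F i)) ->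
  - 3 / 4 <= EB n f <= 3 / 4 -> - 3 / 4 <= EB n g <= 3 / 4 ->
  - 3 / 4 <= EB n h <= 3 / 4 ->
  (kbal / 100 * e) ^+ 2 / 18 <= Msum R n F.
Proof.
move=> pf pg ph NE N0 NM e0 e1 De bf bg bh.
have NT_N : NT n f g h <= N by rewrite NE; exact: NT_le_err3.
have k0 := kbal_gt0; have k1 := kbal_le1.
have ke0 : 0 <= kbal * e by rewrite mulr_ge0 // ltW.
have kee : kbal * e <= e by rewrite ler_piMl // ltW.
have kek : kbal * e <= kbal by rewrite ler_piMr // ltW.
have big : kbal / 100 * e <= N -> (kbal / 100 * e) ^+ 2 / 18 <= Msum R n F.
  move=> H; have : (kbal / 100 * e) ^+ 2 <= N ^+ 2 by rewrite lerXn2r ?nnegrE //; lra.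
  lra.
case: (lerP (1 / 100) N) => N1; first by apply: big; lra.
case: (lerP kbal (NT n f g h)) => nt; first by apply: big; lra.
have [i [[] [i_n di]]] := NT_central pf pg ph bf bg bh nt.
  apply: big; have := wrong_le true F pf pg ph i_n; rewrite -NE.
  by have := De i i_n; lra.
have := wrong_le false F pf pg ph i_n; rewrite -NE /= => H.
have := bottom_manip R F i_n.
have : (kbal / 100 * e) ^+ 2 <= 1 by rewrite expr_le1 //; lra.
lra.
Qed.

Lemma manip_bound n F (e : R) : 0 < e ->
  (forall i, (i < n)%N -> e <= Ex L6 n (wrong R topc F i)) ->
  (forall k, (k < 3)%N -> e <= Palt R n F k) ->
  (kbias * kbal / 100 / 18) ^+ 2 * e ^+ 6 <= Msum R n F /\
  ((forall k, (k < 3)%N -> Palt R n F k = 1 / 3) ->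
    (kbal / 100) ^+ 2 / 18 * e ^+ 2 <= Msum R n F).
Proof.
move=> e0 De Pe.
have [f pf Hf] := social01 R n F; have [g pg Hg] := social12 R n F.
have [h ph Hh] := social20 R n F.
set e1 := Ex L6 n (err 0 1 c0 F f) in Hf; set e2 := Ex L6 n (err 1 2 c1 F g) in Hg.
set e3 := Ex L6 n (err 2 0 c2 F h) in Hh.
pose N := Ex L6 n (err3 F f g h).
have NE : N = e1 + e2 + e3 by rewrite /e1 /e2 /e3 -!ExD.
have e1_0 : 0 <= e1 by apply: Ex_ge0 => s; exact: err_ge0.
have e2_0 : 0 <= e2 by apply: Ex_ge0 => s; exact: err_ge0.
have e3_0 : 0 <= e3 by apply: Ex_ge0 => s; exact: err_ge0.
have N0 : 0 <= N by lra.
have NM : N ^+ 2 <= 18 * Msum R n F.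
  rewrite NE; have := sqr_ge0 (e1 - e2); have := sqr_ge0 (e2 - e3).
  have := sqr_ge0 (e3 - e1); move: Hf Hg Hh; clear; lra.
have NT_N : NT n f g h <= N by exact: NT_le_err3.
have x0 G : Ex L6 n (fun s => G (map c0 s)) = EB n G :> R := E3_x n G.
have x1 G : Ex L6 n (fun s => G (map c1 s)) = EB n G :> R := E3_y n G.
have x2 G : Ex L6 n (fun s => G (map c2 s)) = EB n G :> R := E3_z n G.
have mean (d : R) : (forall k, (k < 3)%N -> d + N <= Palt R n F k) ->
   [/\ 2 * d - 1 <= EB n f <= 1 - 2 * d, 2 * d - 1 <= EB n g <= 1 - 2 * d
     & 2 * d - 1 <= EB n h <= 1 - 2 * d].
  move=> Pd; have P0 := Pd 0%N isT; have P1 := Pd 1%N isT; have P2 := Pd 2%N isT.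
  have := @Palt_le_pos _ n 0 1 c0 F f pf x0; have := @Palt_le_neg _ n 0 1 c0 F f pf x0.
  have := @Palt_le_pos _ n 1 2 c1 F g pg x1; have := @Palt_le_neg _ n 1 2 c1 F g pg x1.
  have := @Palt_le_pos _ n 2 0 c2 F h ph x2; have := @Palt_le_neg _ n 2 0 c2 F h ph x2.
  rewrite -/e1 -/e2 -/e3; move: P0 P1 P2 NE e1_0 e2_0 e3_0; clear => *.
  by split; apply/andP; split; lra.
have e_le1 : e <= 1.
  have : Palt R n F 0 <= 1 by apply: Ex_le1 => // s; case: eqP.
  by have := Pe 0%N isT; lra.
have k0 := kbal_gt0; have k1 := kbal_le1; have l0 := kbias_gt0; have l1 := kbias_le1.
have ke0 : 0 <= kbal * e by rewrite mulr_ge0 // ltW.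
have kee : kbal * e <= e by rewrite ler_piMl // ltW.
have kek : kbal * e <= kbal by rewrite ler_piMr // ltW.
have sq x : 0 <= x -> x <= N -> x ^+ 2 / 18 <= Msum R n F.
  move=> x00 xN; have : x ^+ 2 <= N ^+ 2 by rewrite lerXn2r ?nnegrE //; lra.
  lra.
have cen := central_manip pf pg ph (erefl N) N0 NM e0 e_le1 De.
split=> [|P3].
  have e30 : 0 <= e ^+ 3 := exprn_ge0 _ (ltW e0).
  have e3e : e ^+ 3 <= e by rewrite -[leRHS]expr1; apply: ler_wiXn2l => //; exact: ltW.
  (* One quantity below the thresholds e, kbal e and kbias e^3 of the three cases. *)
  pose X := kbias * (kbal * e ^+ 3).
  have ke3 : 0 <= kbal * e ^+ 3 by rewrite mulr_ge0 // ltW.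
  have X0 : 0 <= X by rewrite mulr_ge0 // ltW.
  have Xe : X <= kbal * e.
    rewrite /X; apply: (@le_trans _ _ (kbal * e ^+ 3)); first by rewrite ler_piMl.
    by rewrite ler_wpM2l // ltW.
  have Xk : X <= kbias * e ^+ 3.
    by apply: ler_wpM2l; [exact: ltW|exact: ler_piMl].
  have toX (Y : R) : X <= Y -> Y ^+ 2 / 18 / 100 / 100 <= Msum R n F ->
      (kbias * kbal / 100 / 18) ^+ 2 * e ^+ 6 <= Msum R n F.
    move=> XY; apply: le_trans.
    have -> : (kbias * kbal / 100 / 18) ^+ 2 * e ^+ 6 = X ^+ 2 / 18 / 18 / 100 / 100.
      by rewrite /X; field.
    have : X ^+ 2 <= Y ^+ 2 by rewrite lerXn2r ?nnegrE //; lra.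
    have := sqr_ge0 X; clear; lra.
  case: (lerP (e / 2) N) => N1.
    by apply: (toX e); [lra|have := sq (e / 2) ltac:(lra) N1; have := sqr_ge0 e; clear; lra].
  have [bf bg bh] := mean (e / 2) (fun k kk => ltac:(have := Pe k kk; lra)).
  have he : 0 < e / 2 by lra.
  have bias : expR (- 20) * (e / 2) ^+ 3 <= NT n f g h ->
      (kbias * kbal / 100 / 18) ^+ 2 * e ^+ 6 <= Msum R n F.
    have -> : expR (- 20) * (e / 2) ^+ 3 = kbias * e ^+ 3 by rewrite /kbias; field.
    move=> H; apply: (toX (kbias * e ^+ 3)) => //.
    have Y0 : 0 <= kbias * e ^+ 3 by rewrite mulr_ge0 // ltW.
    have := sq _ Y0 (le_trans H NT_N); have := sqr_ge0 (kbias * e ^+ 3).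
    by move: (kbias * e ^+ 3) (Msum R n F); clear => Y M; lra.
  case: (boolP (- 3 / 4 < EB n f < 3 / 4)) => cf; last first.
    by apply: bias; exact: NT_biased.
  case: (boolP (- 3 / 4 < EB n g < 3 / 4)) => cg; last first.
    by apply: bias; rewrite NT_rot; exact: NT_biased.
  case: (boolP (- 3 / 4 < EB n h < 3 / 4)) => ch; last first.
    by apply: bias; rewrite 2!NT_rot; exact: NT_biased.
  have W (x : R) : - 3 / 4 < x < 3 / 4 -> - 3 / 4 <= x <= 3 / 4.
    by case/andP=> x1' x2'; rewrite !ltW.
  apply: (toX _ Xe); have := cen (W _ cf) (W _ cg) (W _ ch).
  by move: (Msum R n F); clear => M; lra.
have -> : (kbal / 100) ^+ 2 / 18 * e ^+ 2 = (kbal / 100 * e) ^+ 2 / 18 by field.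
case: (lerP (1 / 5) N) => N1; first by apply: sq; lra.
(* 1/8 + 1/5 <= 1/3, and d = 1/8 yields means within 3/4, so no biased case is left. *)
have [bf bg bh] := mean (1 / 8) (fun k kk => ltac:(rewrite P3 //; lra)).
have W (x : R) : 2 * (1 / 8) - 1 <= x <= 1 - 2 * (1 / 8) -> - 3 / 4 <= x <= 3 / 4.
  by clear; case/andP=> *; apply/andP; split; lra.
by apply: cen; apply: W.
Qed.

End Core.

                          

(** * From profiles of permutations to sequences of codes *)

Section Profiles.
Variable R : realFieldType.

Definition ofs (T : finType) (d : T) n (s : seq T) : {ffun 'I_n -> T} :=
  [ffun i => nth d s (nat_of_ord i)].

Lemma sum_ffun_recl (T : finType) n (G : {ffun 'I_n.+1 -> T} -> R) :
  \sum_x G x = \sum_(t : T) \sum_(y : {ffun 'I_n -> T})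
    G [ffun i => if unlift ord0 i is Some j then y j else t].
Proof.
rewrite pair_big /=.
rewrite (reindex (fun p : T * {ffun 'I_n -> T} =>
  [ffun i => if unlift ord0 i is Some j then p.2 j else p.1])) //=.
exists (fun x : {ffun 'I_n.+1 -> T} => (x ord0, [ffun j => x (lift ord0 j)])).
  move=> [t y] _; congr pair; first by rewrite ffunE unlift_none.
  by apply/ffunP => j; rewrite !ffunE liftK.
move=> x _; apply/ffunP => i; rewrite ffunE /=.
by case: unliftP => [j ->|->] //=; rewrite ffunE.
Qed.

Lemma Ex_ffun (T : finType) (d : T) n (G : {ffun 'I_n -> T} -> R) :
  Ex (enum T) n (fun s => G (ofs d n s)) = (\sum_x G x) / (#|{ffun 'I_n -> T}|)%:R.
Proof.
elim: n G => [|n IH] G.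
  rewrite /= (big_pred1 (ofs d 0 [::])) => [|x /=].
    by rewrite card_ffun card_ord expn0 divr1.
  by apply/esym/eqP/ffunP => -[].
rewrite ExS sum_ffun_recl -cardE big_enum /= !card_ffun !card_ord expnS natrM invfM.
rewrite [RHS]mulrA [RHS]mulrAC; congr (_ / _).
rewrite mulr_suml; apply: eq_bigr => t _.
have -> : (#|T| ^ n)%N = #|{ffun 'I_n -> T}| by rewrite card_ffun card_ord.
rewrite -IH; apply: eq_Ex => s; congr G; apply/ffunP => i; rewrite !ffunE.
by case: unliftP => [j ->|->] //=; rewrite ffunE.
Qed.

Lemma Pr_sum (T : finType) (E : pred T) : Pr R E = (\sum_t (E t)%:R) / (#|T|)%:R.
Proof.
congr (_ / _); rewrite -sum1_card natr_sum big_mkcond /=.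
by apply: eq_bigr => t _; rewrite inE; case: (E t).
Qed.

Definition o0 : 'I_3 := @Ordinal 3 0 isT.
Definition o1 : 'I_3 := @Ordinal 3 1 isT.
Definition o2 : 'I_3 := @Ordinal 3 2 isT.

Definition codeof (s : lorder 3) : code := (prefers s o0 o1, prefers s o1 o2, prefers s o2 o0).

Definition rk (s : lorder 3) (a : 'I_3) : nat := nat_of_ord ((s^-1)%g a).

Lemma rkP s : [/\ (rk s o0 < 3)%N, (rk s o1 < 3)%N, (rk s o2 < 3)%N &
  [/\ rk s o0 <> rk s o1, rk s o1 <> rk s o2 & rk s o2 <> rk s o0]].
Proof. by split; try exact: ltn_ord; split=> /ord_inj/perm_inj. Qed.

Lemma prefersE s a b : prefers s a b = (rk s a < rk s b)%N.
Proof. by []. Qed.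

Lemma I3E (a : 'I_3) : [\/ a = o0, a = o1 | a = o2].
Proof.
by case: (I3P a) => H; [constructor 1|constructor 2|constructor 3]; apply: ord_inj.
Qed.

Lemma codeof_L6 s : codeof s \in L6.
Proof.
have [a b c [d e f]] := rkP s; rewrite /codeof !prefersE.
case: ltnP => h1; case: ltnP => h2; case: ltnP => h3 //; lia.
Qed.

Lemma codeof_inj : injective codeof.
Proof.
move=> s s' ss'; apply: invg_inj.
have [a b c [d e f]] := rkP s; have [a' b' c' [d' e' f']] := rkP s'.
move: ss'; rewrite /codeof !prefersE => -[h1 h2 h3].
apply/permP => x; apply: ord_inj; rewrite -!/(rk _ _); case: (I3E x) => ->; lia.
Qed.

Lemma codeof_perm : perm_eq (map codeof (enum (lorder 3))) L6.
Proof.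
apply: uniq_perm => //; first by rewrite (map_inj_uniq codeof_inj) enum_uniq.
have [] := @uniq_min_size _ (map codeof (enum (lorder 3))) L6 => //.
- by rewrite (map_inj_uniq codeof_inj) enum_uniq.
- by move=> c /mapP[s _ ->]; exact: codeof_L6.
- by rewrite size_map -cardE card_Sn.
Qed.

(** Inverse of [codeof] on [L6]; the identity is a dummy value for the two cyclic triples. *)
Definition decode (c : code) : lorder 3 :=
  odflt 1%g [pick s : lorder 3 | codeof s == c].

Lemma codeofK : cancel codeof decode.
Proof.
move=> s; rewrite /decode; case: pickP => [s' /eqP/codeof_inj //|/(_ s)].
by rewrite eqxx.
Qed.

Lemma decodeK c : c \in L6 -> codeof (decode c) = c.
Proof. by rewrite -(perm_mem codeof_perm) => /mapP[s _ ->]; rewrite codeofK. Qed.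

Lemma decode_perm : perm_eq (map decode L6) (enum (lorder 3)).
Proof.
rewrite perm_sym -[X in perm_eq X _](mapK codeofK).
exact: perm_map codeof_perm.
Qed.

Lemma prefE s (a b : 'I_3) : pref (codeof s) a b = prefers s a b.
Proof.
have [p q r [d e f]] := rkP s.
rewrite /codeof !prefersE.
case: (I3E a) => ->; case: (I3E b) => ->; rewrite /= ?ltnn // /c0 /c1 /c2 /=; lia.
Qed.

Lemma topcE s : topc (codeof s) = nat_of_ord (top s).
Proof.
have H a : rk s a = 0%N -> nat_of_ord a = top s.
  by move=> a0; rewrite /top -[in LHS](permKV s a); congr (nat_of_ord (s _)); exact: ord_inj.
have [p q r [d e f]] := rkP s.
rewrite /topc /codeof /c0 /c1 /c2 /= !prefersE.
case: ifP => h1; first by rewrite -(H o0) //; lia.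
case: ifP => h2; first by rewrite -(H o1) //; lia.
by rewrite -(H o2) //; lia.
Qed.

Lemma Ex_decode n (G : seq (lorder 3) -> R) :
  Ex (enum (lorder 3)) n G = Ex L6 n (fun s => G (map decode s)).
Proof. by rewrite Ex_map (Ex_perm _ _ decode_perm). Qed.

Lemma PrE n (E : pred (profile n 3)) :
  Pr R E = Ex L6 n (fun s => (E (ofs 1%g n (map decode s)))%:R).
Proof. by rewrite Pr_sum -(Ex_ffun 1%g) Ex_decode. Qed.

Variables (n : nat) (F : SCF n 3).

Definition scf (s : seq code) : 'I_3 := F (ofs 1%g n (map decode s)).

Lemma ofs_decode s (i : 'I_n) : size s = n ->
  ofs 1%g n (map decode s) i = decode (nth cd0 s i).
Proof. by move=> sn; rewrite ffunE (nth_map cd0) // sn. Qed.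

Lemma Pr_alt (a : 'I_3) : Pr R (fun x => F x == a) = Palt R n scf a.
Proof. exact: PrE. Qed.

Lemma Pr_top (i : 'I_n) : Pr R (fun x => F x != top (x i)) = Ex L6 n (wrong R topc scf i).
Proof.
rewrite PrE; apply: eq_Ex_in => s sn sL; rewrite /wrong -/(scf s) ofs_decode //.
have cL : nth cd0 s i \in L6 by apply: (allP sL); rewrite mem_nth // sn.
by rewrite -[in RHS](decodeK cL) topcE.
Qed.

Lemma upd_decode s (i : 'I_n) c : size s = n ->
  upd (ofs 1%g n (map decode s)) i (decode c) = ofs 1%g n (map decode (set_nth cd0 s i c)).
Proof.
move=> sn; apply/ffunP => j; rewrite ffunE.
rewrite [in RHS]ofs_decode ?nth_set_nth /=; last first.
  by rewrite size_set_nth sn; apply/maxn_idPr.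
case: eqP => [->|/eqP ji]; first by rewrite eqxx.
by rewrite (ofs_decode j sn) ifN // (inj_eq (@ord_inj n)).
Qed.

Lemma manip_powerE (i : 'I_n) : manip_power R F i = Ex L6 n (fun s =>
  (\sum_(t <- L6) (pref (nth cd0 s i) (scf (set_nth cd0 s i t)) (scf s))%:R) / 6).
Proof.
rewrite /manip_power Pr_sum card_prod natrM invfM mulrA.
rewrite -(pair_bigA _ (fun (x : profile n 3) (t : lorder 3) => (prefers (x i) (F (upd x i t)) (F x))%:R)) /=.
rewrite -mulrA [_^-1 / _]mulrC mulrA mulr_suml -(Ex_ffun 1%g) Ex_decode.
apply: eq_Ex_in => s sn sL.
have c6 : #|lorder 3| = 6%N by rewrite cardE -(perm_size decode_perm).
rewrite c6; congr (_ / _).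
rewrite -big_enum -(perm_big _ decode_perm) big_map big_seq [RHS]big_seq.
apply: eq_bigr => t tL; rewrite ofs_decode // upd_decode // -/(scf s) -/(scf (set_nth _ _ _ _)).
have cL : nth cd0 s i \in L6 by apply: (allP sL); rewrite mem_nth // sn.
by rewrite -prefE decodeK.
Qed.

Lemma Msum_manip : \sum_(i < n) manip_power R F i = Msum R n scf.
Proof. by apply: eq_bigr => i _; exact: manip_powerE. Qed.

(** Relabelling by a transposition is a bijection of profiles, so neutrality makes the three
    outcomes equally likely. *)
Lemma neutral_uniform : neutral F -> forall a : 'I_3, Palt R n scf a = 1 / 3.
Proof.
move=> neu.
have inv (p : {perm 'I_3}) a : Pr R (fun x => F x == p a) = Pr R (fun x => F x == a).
  rewrite !Pr_sum; congr (_ / _).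
  rewrite (reindex (fun x : profile n 3 => [ffun j => relabel p (x j)])) /=.
    by apply: eq_bigr => x _; rewrite neu (inj_eq perm_inj).
  exists (fun x : profile n 3 => [ffun j => relabel p^-1%g (x j)]) => x _;
    by apply/ffunP => j; rewrite !ffunE /relabel ?mulgK ?mulgKV.
have eqP3 (a b : 'I_3) : Palt R n scf a = Palt R n scf b.
  by rewrite -!Pr_alt -(inv (tperm a b)) tpermL.
have sum1 : Palt R n scf o0 + Palt R n scf o1 + Palt R n scf o2 = 1.
  rewrite /Palt -!ExD -[RHS](@Ex_cst R _ L6 n) //; apply: eq_Ex => s.
  by case: (I3P (scf s)) => -> /=; ring.
move=> a; have := eqP3 o0 a; have := eqP3 o1 a; have := eqP3 o2 a.
lra.
Qed.

End Profiles.

(** * Transfer to an arbitrary real field *)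

Lemma Pr_ratr (K : realFieldType) (T : finType) (E : pred T) : Pr K E = ratr (Pr rat E).
Proof. by rewrite /Pr fmorph_div !rmorph_nat. Qed.

Lemma sum_manip_ratr (K : realFieldType) n (F : SCF n 3) :
  \sum_(i < n) manip_power K F i = ratr (\sum_(i < n) manip_power rat F i).
Proof. by rewrite rmorph_sum; apply: eq_bigr => i _; exact: Pr_ratr. Qed.

(** Lets the possibly irrational eps be replaced by the least of the finitely many rational
    probabilities that it bounds, which only strengthens the conclusion. *)
Lemma rational_min (K : realFieldType) (eps : K) (x0 : rat) (l : seq rat) :
  (forall x, x \in x0 :: l -> eps <= ratr x) ->
  exists2 q : rat, eps <= ratr q & forall x, x \in x0 :: l -> q <= x.
Proof.
elim: l x0 => [|y l IH] x0 H.
  by exists x0 => [|x]; [apply: H; exact: mem_head | rewrite inE => /eqP ->].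
have [q q1 q2] := IH y (fun x xl => H x (mem_behead (s := x0 :: y :: l) xl)).
case: (lerP q x0) => qx.
  exists q => // x; rewrite inE => /orP[/eqP -> //|]; exact: q2.
exists x0 => [|x]; first by apply: H; exact: mem_head.
rewrite inE => /orP[/eqP -> //|xl]; exact: le_trans (ltW qx) (q2 _ xl).
Qed.

Lemma rational_below (k : Rdefinitions.R) : 0 < k -> exists2 q : rat, 0 < q & ratr q <= k.
Proof.
move=> k0; have [q] := rat_in_itvoo k0; rewrite in_itv /= => /andP[q0 qk].
by exists q; [move: q0; rewrite ltr0q | exact: ltW].
Qed.

Lemma manip_bound_rat : exists C C' : rat, 0 < C /\ 0 < C' /\
  forall n (F : SCF n 3) (q : rat), 0 < q ->
    (forall i : 'I_n, q <= Pr rat (fun x : profile n 3 => F x != top (x i))) ->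
    (forall a : 'I_3, q <= Pr rat (fun x : profile n 3 => F x == a)) ->
    C * q ^+ 6 <= \sum_(i < n) manip_power rat F i /\
    (neutral F -> C' * q ^+ 2 <= \sum_(i < n) manip_power rat F i).
Proof.
pose R0 : realType := Rdefinitions.R.
pose K1 : R0 := (kbias R0 * kbal R0 / 100 / 18) ^+ 2.
pose K2 : R0 := (kbal R0 / 100) ^+ 2 / 18.
have K1_0 : 0 < K1.
  by rewrite exprn_gt0 // !divr_gt0 // mulr_gt0 ?kbias_gt0 ?kbal_gt0.
have K2_0 : 0 < K2 by rewrite divr_gt0 // exprn_gt0 // divr_gt0 // kbal_gt0.
have [C C0 CK] := rational_below K1_0; have [C' C'0 CK'] := rational_below K2_0.
exists C, C'; do 2 split=> //; move=> n F q q0 Dq Pq.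
have e0 : 0 < ratr q :> R0 by rewrite ltr0q.
have De i : (i < n)%N -> ratr q <= Ex L6 n (wrong R0 topc (scf F) i).
  move=> i_n; have := Dq (Ordinal i_n).
  by rewrite -(ler_rat R0) -Pr_ratr Pr_top.
have Pe k : (k < 3)%N -> ratr q <= Palt R0 n (scf F) k.
  move=> k3; have := Pq (Ordinal k3).
  by rewrite -(ler_rat R0) -Pr_ratr Pr_alt.
have [H1 H2] := manip_bound e0 De Pe.
split=> [|neu]; rewrite -(ler_rat R0) -sum_manip_ratr Msum_manip rmorphM rmorphXn.
  by apply: le_trans H1; rewrite ler_wpM2r // exprn_ge0 // ltW.
apply: (le_trans _ (H2 _)); first by rewrite ler_wpM2r // exprn_ge0 // ltW.
by move=> k k3; exact: (neutral_uniform R0 neu (Ordinal k3)).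
Qed.

Theorem theorem1p3 :
  exists C C' : rat, 0 < C /\ 0 < C' /\
  forall (R : realFieldType) (eps : R) (n : nat), 0 < eps -> (0 < n)%N ->
  forall F : SCF n 3,
    (forall i : 'I_n, eps <= Pr R (fun x : profile n 3 => F x != top (x i))) ->
    (forall a : 'I_3, eps <= Pr R (fun x : profile n 3 => F x == a)) ->
    ratr C * eps ^+ 6 <= \sum_(i < n) manip_power R F i /\
    (neutral F -> ratr C' * eps ^+ 2 <= \sum_(i < n) manip_power R F i).
Proof.
have [C [C' [C0 [C'0 H]]]] := manip_bound_rat.
exists C, C'; do 2 split=> //; move=> R eps n eps0 _ F De Pe.
pose D i := Pr rat (fun x : profile n 3 => F x != top (x i)).
pose P a := Pr rat (fun x : profile n 3 => F x == a).
have [q q1 q2] : exists2 q : rat, eps <= ratr q & forall x,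
    x \in [:: P o0, P o1, P o2 & [seq D i | i <- enum 'I_n]] -> q <= x.
  apply: rational_min => x; rewrite !inE.
  by case/or4P => [/eqP ->|/eqP ->|/eqP ->|/mapP[i _ ->]]; rewrite -Pr_ratr.
have q0 : 0 < q by rewrite -(ltr0q R); exact: lt_le_trans q1.
have Dq i : q <= D i.
  by apply: q2; rewrite !inE map_f ?orbT // mem_enum.
have Pq a : q <= P a.
  by apply: q2; case: (I3E a) => ->; rewrite !inE ?eqxx ?orbT.
have [H1 H2] := H n F q q0 Dq Pq.
have pw k : eps ^+ k <= ratr (q ^+ k).
  by rewrite rmorphXn lerXn2r ?nnegrE ?ler0q // ltW.
rewrite sum_manip_ratr; split=> [|neu].
  apply: (@le_trans _ _ (ratr (C * q ^+ 6))); last by rewrite ler_rat.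
  by rewrite rmorphM ler_wpM2l // ler0q ltW.
apply: (@le_trans _ _ (ratr (C' * q ^+ 2))); last by rewrite ler_rat; exact: H2.
by rewrite rmorphM ler_wpM2l // ler0q ltW.
Qed.
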